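(* Let $\mathbb{W}=(\mathbb{W}_A)_{A\in\mathcal{B}_0(\mathbb{R}^d)}$ be the spatial $G$-white noise with parameters $0\le\underline{\sigma}^2\le\overline{\sigma}^2$ and generating functions $\frac12\hat{\mathbb{E}}[\langle Q\mathbb{W}_{\underline{\gamma}},\mathbb{W}_{\underline{\gamma}}\rangle]=G\big(\sum_{i,j=1}^nq_{ij}\lambda_{A_i\cap A_j}\big)$ for $\underline{\gamma}=(A_1,\dots,A_n)$, $\mathbb{W}_{\underline{\gamma}}=(\mathbb{W}_{A_1},\dots,\mathbb{W}_{A_n})$ and $Q=(q_{ij})\in\mathbb{S}(n)$, where $G(a)=\frac12(\overline{\sigma}^2a^+-\underline{\sigma}^2a^-)$. For $p\in\mathbb{R}^d$ and $O\in\mathbb{O}(d)=\{O\in\mathbb{R}^{d\times d}:O^T=O^{-1}\}$ set $T_{p,O}(A)=\{Ox+p:x\in A\}$. Then for each $p\in\mathbb{R}^d$, $O\in\mathbb{O}(d)$ and $A_1,\dots,A_n\in\mathcal{B}_0(\mathbb{R}^d)$, $$(\mathbb{W}_{A_1},\dots,\mathbb{W}_{A_n})\overset{d}{=}(\mathbb{W}_{T_{p,O}(A_1)},\dots,\mathbb{W}_{T_{p,O}(A_n)}),$$ i.e. the finite dimensional distributions of $\mathbb{W}$ are invariant under rotations and translations.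
   Context: $C_{l.Lip}(\mathbb{R}^k)$ is the space of $\varphi:\mathbb{R}^k\to\mathbb{R}$ with $|\varphi(x)-\varphi(y)|\le C(1+|x|^q+|y|^q)|x-y|$ for some $C>0,q\in\mathbb{N}$. A sublinear expectation space $(\Omega,\mathcal{H},\hat{\mathbb{E}})$: $\Omega$ a nonempty set, $\mathcal{H}$ a linear space of real functions on $\Omega$ with $\varphi(X_1,\dots,X_k)\in\mathcal{H}$ whenever $X_i\in\mathcal{H}$ and $\varphi\in C_{l.Lip}(\mathbb{R}^k)$, and $\hat{\mathbb{E}}:\mathcal{H}\to\mathbb{R}$ monotone, constant preserving, sub-additive and positively homogeneous. $X_1\overset{d}{=}X_2$ means $\hat{\mathbb{E}}[\varphi(X_1)]=\hat{\mathbb{E}}[\varphi(X_2)]$ for all $\varphi\in C_{l.Lip}$. $Y$ is independent from $X$ if $\hat{\mathbb{E}}[\varphi(X,Y)]=\hat{\mathbb{E}}[\hat{\mathbb{E}}[\varphi(x,Y)]_{x=X}]$ for all $\varphi\in C_{l.Lip}$. An independent copy $\bar X$ of $X$ satisfies $\bar X\overset{d}{=}X$ and is independent from $X$ (realised, if necessary, on a larger sublinear expectation space). $X$ is $G$-normally distributed if $aX+b\bar X\overset{d}{=}\sqrt{a^2+b^2}X$ for all $a,b\ge0$. $\mathbb{S}(n)$: symmetric real $n\times n$ matrices. $\mathcal{B}_0(\mathbb{R}^d)=\{A\in\mathcal{B}(\mathbb{R}^d):\lambda_A<\infty\}$, $\lambda_A$ the Lebesgue measure. A $1$-dimensional $G$-Gaussian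 random field is a family $(\mathbb{W}_\gamma)_{\gamma\in\Gamma}$ in $\mathcal{H}$ all of whose finite subvectors (with distinct indices) are $G$-normally distributed. A spatial $G$-white noise with parameters $\underline{\sigma}^2\le\overline{\sigma}^2$ is a $1$-dimensional $G$-Gaussian random field $(\mathbb{W}_A)_{A\in\mathcal{B}_0(\mathbb{R}^d)}$ such that (i) $\hat{\mathbb{E}}[\mathbb{W}_A^2]=\overline{\sigma}^2\lambda_A$ and $-\hat{\mathbb{E}}[-\mathbb{W}_A^2]=\underline{\sigma}^2\lambda_A$; (ii) for $A_1\cap A_2=\emptyset$, $\hat{\mathbb{E}}[\pm\mathbb{W}_{A_1}\mathbb{W}_{A_2}]=0$ and $\hat{\mathbb{E}}[(\mathbb{W}_{A_1\cup A_2}-\mathbb{W}_{A_1}-\mathbb{W}_{A_2})^2]=0$. *)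

(* Defs.v *)
From HB Require Import structures.
From mathcomp Require Export all_boot all_order all_algebra.
From mathcomp Require Export all_classical all_reals all_analysis.
Export Order.TTheory GRing.Theory Num.Theory.
Export numFieldNormedType.Exports.

#[export] Set Implicit Arguments.
#[export] Unset Strict Implicit.
#[export] Unset Printing Implicit Defensive.

Global Open Scope classical_set_scope.
Global Open Scope ring_scope.

Section Euclidean.
Context {R : realType}.

Definition dotp n (x y : 'cV[R]_n) : R := \sum_(i < n) x i 0 * y i 0.

(* The norm that the library puts on matrices is the sup norm, whence this
   explicit Euclidean norm. *)
Definition enorm n (x : 'cV[R]_n) : R := Num.sqrt (dotp x x).

Definition borel d (A : set 'cV[R]_d) : Prop := <<s @open 'cV[R]_d >> A.

End Euclidean.

Section LebesgueCons.
Local Open Scope ereal_scope.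
Context {R : realType} (d : nat).
Variable mu : {sigma_finite_measure set (d.-tuple (measurableTypeR R)) -> \bar R}.

Definition tuple_cons (p : measurableTypeR R * d.-tuple (measurableTypeR R)) :
  d.+1.-tuple (measurableTypeR R) := [tuple of p.1 :: p.2].

Lemma measurable_tuple_cons : measurable_fun [set: _] tuple_cons.
Proof. exact: measurable_cons. Qed.

Definition lebesgue_cons : set (d.+1.-tuple (measurableTypeR R)) -> \bar R :=
  pushforward (@lebesgue_measure R \x mu) tuple_cons.

Let lebesgue_cons0 : lebesgue_cons set0 = 0.
Proof.
by rewrite /lebesgue_cons /pushforward preimage_set0; exact: measure0.
Qed.

Let lebesgue_cons_ge0 A : 0 <= lebesgue_cons A.
Proof. exact: (measure_ge0 (@lebesgue_measure R \x mu)). Qed.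

Let lebesgue_cons_sigma_additive : semi_sigma_additive lebesgue_cons.
Proof.
move=> F mF tF mUF; rewrite /lebesgue_cons /pushforward preimage_bigcup.
apply: (@measure_semi_sigma_additive _ _ _ (@lebesgue_measure R \x mu)).
- by move=> n; rewrite -[X in measurable X]setTI; exact: measurable_tuple_cons.
- apply/trivIsetP => /= i j _ _ ij; rewrite -preimage_setI.
  by move/trivIsetP : tF => /(_ _ _ _ _ ij) ->//; rewrite preimage_set0.
- rewrite -preimage_bigcup -[X in measurable X]setTI.
  exact: measurable_tuple_cons.
Qed.

HB.instance Definition _ := isMeasure.Build _ _ _ lebesgue_cons
  lebesgue_cons0 lebesgue_cons_ge0 lebesgue_cons_sigma_additive.

Let uncons (t : d.+1.-tuple (measurableTypeR R)) :
  measurableTypeR R * d.-tuple (measurableTypeR R) :=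
  (thead t, [tuple of behead t]).

Let measurable_uncons : measurable_fun [set: _] uncons.
Proof.
apply/measurable_fun_pairP; split => /=.
- exact: (measurable_tnth ord0).
- exact: measurable_behead.
Qed.

Let tuple_consK : cancel tuple_cons uncons.
Proof.
by case=> x t; rewrite /uncons /tuple_cons theadE; congr pair; exact: val_inj.
Qed.

Let lebesgue_cons_sigma_finite : sigma_finite setT lebesgue_cons.
Proof.
have /sigma_finiteP[F [TF ndF mF]] := sigma_finiteT (@lebesgue_measure R).
have /sigma_finiteP[G [TG ndG mG]] := sigma_finiteT mu.
exists (fun n => uncons @^-1` (F n `*` G n)).
  rewrite -preimage_bigcup -[LHS](preimage_setT uncons); congr (_ @^-1` _).
  apply/esym; rewrite -subTset => -[x y] _.
  have [i _ Fx] : (\bigcup_i F i) x by rewrite -TF.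
  have [j _ Gy] : (\bigcup_i G i) y by rewrite -TG.
  exists (maxn i j) => //; split => /=.
  - by move: x Fx; exact/subsetPset/ndF/leq_maxl.
  - by move: y Gy; exact/subsetPset/ndG/leq_maxr.
move=> n; have [mFn Fn_fin] := mF n; have [mGn Gn_fin] := mG n; split.
  by rewrite -[X in measurable X]setTI; apply: measurable_uncons => //;
    exact: measurableX.
rewrite /lebesgue_cons /pushforward -comp_preimage.
rewrite (_ : _ \o _ = id); last by apply/funext => x /=; rewrite tuple_consK.
by rewrite /= product_measure1E// lte_mul_pinfty// ge0_fin_numE.
Qed.

HB.instance Definition _ := Measure_isSigmaFinite.Build _ _ _ lebesgue_cons
  lebesgue_cons_sigma_finite.

End LebesgueCons.

Fixpoint lebesgue_tuple {R : realType} (d : nat) :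
    {sigma_finite_measure set (d.-tuple (measurableTypeR R)) -> \bar R} :=
  match d with
  | 0 => \d_([tuple] : 0.-tuple (measurableTypeR R))
  | d'.+1 => lebesgue_cons (lebesgue_tuple d')
  end.

Definition lebesgue {R : realType} d (A : set 'cV[R]_d) : \bar R :=
  lebesgue_tuple d [set t | A (\col_(i < d) tnth t i)].

Lemma lebesgue_tuple_box {R : realType} d (a b : 'I_d -> R) :
  (forall i, a i <= b i) ->
  measurable [set t : d.-tuple (measurableTypeR R) |
    forall i, a i < tnth t i <= b i] /\
  lebesgue_tuple d [set t | forall i, a i < tnth t i <= b i] =
    (\prod_(i < d) (b i - a i))%:E.
Proof.
elim: d a b => [|d IH] a b ab.
  have -> : [set t : 0.-tuple (measurableTypeR R) |
      forall i, a i < tnth t i <= b i] = setT.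
    by apply/seteqP; split => // t _ [].
  split; first exact: measurableT.
  by rewrite big_ord0 /= diracE in_setT.
have [mB vB] := IH (a \o lift ord0) (b \o lift ord0) (fun i => ab (lift ord0 i)).
set B := (X in measurable X) in mB; rewrite -/B in vB.
set C := (X in measurable X).
have mI : measurable (`]a ord0, b ord0] : set (measurableTypeR R)).
  exact: measurable_itv.
have CE : @tuple_cons R d @^-1` C = `]a ord0, b ord0] `*` B.
  apply/seteqP; split => [[x t] /= H|[x t] /= [H0 H] i].
    split => /=; first by have := H ord0; rewrite tnth0 in_itv.
    by move=> i; have := H (lift ord0 i); rewrite tnthS.
  case: (unliftP ord0 i) => [j ->|->]; first by rewrite tnthS; exact: H.
  by rewrite tnth0; move: H0; rewrite in_itv.
split.
  have -> : C = \bigcap_(i in [set: 'I_d.+1])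
      ((fun t : d.+1.-tuple (measurableTypeR R) => tnth t i) @^-1`
        `]a i, b i]).
    apply/seteqP; split => [t Ct i _ /=|t Ct i]; first by rewrite in_itv; exact: Ct.
    by have := Ct i I; rewrite /= in_itv.
  apply: fin_bigcap_measurable => // i _.
  by rewrite -[X in measurable X]setTI; apply: measurable_tnth => //; exact: measurable_itv.
rewrite /= /lebesgue_cons /pushforward CE product_measure1E// vB.
rewrite big_ord_recl EFinM; congr (_ * _)%E.
apply: (etrans (lebesgue_measure_itv `]a ord0, b ord0])).
rewrite /= lte_fin.
case: ltgtP (ab ord0) => // -> _.
by rewrite subrr.
Qed.

(* The normalization that characterizes Lebesgue measure among the measures on
   the Borel sets of R^d. *)
Lemma lebesgue_box {R : realType} d (a b : 'cV[R]_d) :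
  (forall i, a i 0 <= b i 0) ->
  lebesgue [set x | forall i, a i 0 < x i 0 <= b i 0] =
    (\prod_(i < d) (b i 0 - a i 0))%:E.
Proof.
move=> ab; have [_ <-] := @lebesgue_tuple_box R d (a ^~ 0) (b ^~ 0) ab.
rewrite /lebesgue; congr (lebesgue_tuple d _).
by apply/seteqP; split => t /= H i; have := H i; rewrite mxE.
Qed.

Definition borel_fin {R : realType} d : set (set 'cV[R]_d) :=
  [set A | borel A /\ (lebesgue A < +oo)%E].

Definition clLip {R : realType} k (phi : 'cV[R]_k -> R) : Prop :=
  exists (C : R) (q : nat), 0 < C /\
    forall x y, `|phi x - phi y| <=
      C * (1 + enorm x ^+ q + enorm y ^+ q) * enorm (x - y).

(* The expectation is a total function on [Omega -> R], but it is constrained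
   only on the space [sl_dom] of random variables. *)
Record sublinear_space (R : realType) (Omega : Type) := SublinearSpace {
  sl_dom : set (Omega -> R);
  sl_exp : (Omega -> R) -> R;
  sl_inhab : inhabited Omega;
  sl_dom0 : sl_dom (fun=> 0);
  sl_domD : forall X Y, sl_dom X -> sl_dom Y -> sl_dom (fun w => X w + Y w);
  sl_domZ : forall (c : R) X, sl_dom X -> sl_dom (fun w => c * X w);
  sl_dom_comp : forall k (phi : 'cV[R]_k -> R) (X : Omega -> 'cV[R]_k),
    clLip phi -> (forall i, sl_dom (fun w => X w i 0)) ->
    sl_dom (fun w => phi (X w));
  sl_exp_mono : forall X Y, sl_dom X -> sl_dom Y ->
    (forall w, Y w <= X w) -> sl_exp Y <= sl_exp X;
  sl_exp_cst : forall c : R, sl_exp (fun=> c) = c;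
  sl_exp_subadd : forall X Y, sl_dom X -> sl_dom Y ->
    sl_exp (fun w => X w + Y w) <= sl_exp X + sl_exp Y;
  sl_exp_homo : forall (c : R) X, 0 <= c -> sl_dom X ->
    sl_exp (fun w => c * X w) = c * sl_exp X
}.

Section Distributions.
Context {R : realType} {Omega : Type} (E : sublinear_space R Omega).

Definition rvec k (X : Omega -> 'cV[R]_k) : Prop :=
  forall i, sl_dom E (fun w => X w i 0).

Definition same_law k (X Y : Omega -> 'cV[R]_k) : Prop :=
  forall phi : 'cV[R]_k -> R, clLip phi ->
    sl_exp E (fun w => phi (X w)) = sl_exp E (fun w => phi (Y w)).

Definition indep_from k m (X : Omega -> 'cV[R]_k) (Y : Omega -> 'cV[R]_m)
    : Prop :=
  forall phi : 'cV[R]_(k + m) -> R, clLip phi ->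
    sl_exp E (fun w => phi (col_mx (X w) (Y w))) =
    sl_exp E (fun w => sl_exp E (fun w' => phi (col_mx (X w) (Y w')))).

Definition indep_copy k (X Xbar : Omega -> 'cV[R]_k) : Prop :=
  [/\ rvec Xbar, same_law Xbar X & indep_from X Xbar].

End Distributions.

(* [E'] on [Omega'] is larger than [E] on [Omega]: the random variables of [E]
   are among those of [E'], through composition with [pr], with the same
   expectation. *)
Definition enlarges {R : realType} {Omega Omega' : Type}
    (E : sublinear_space R Omega) (E' : sublinear_space R Omega')
    (pr : Omega' -> Omega) : Prop :=
  forall X, sl_dom E X ->
    sl_dom E' (fun w => X (pr w)) /\ sl_exp E' (fun w => X (pr w)) = sl_exp E X.

(* The law of the pair made of X and an independent copy is determined by the
   law of X, so the choice of the copy and of the larger space is immaterial. *)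
Definition G_normal {R : realType} {Omega : Type} (E : sublinear_space R Omega)
    k (X : Omega -> 'cV[R]_k) : Prop :=
  rvec E X /\
  exists (Omega' : Type) (E' : sublinear_space R Omega') (pr : Omega' -> Omega)
    (Xbar : Omega' -> 'cV[R]_k),
    [/\ enlarges E E' pr, indep_copy E' (fun w => X (pr w)) Xbar &
      forall a b : R, 0 <= a -> 0 <= b ->
        same_law E' (fun w => a *: X (pr w) + b *: Xbar w)
          (fun w => Num.sqrt (a ^+ 2 + b ^+ 2) *: X (pr w))].

Definition subvec {R : realType} {Omega I : Type} (W : I -> Omega -> R)
    n (g : 'I_n -> I) : Omega -> 'cV[R]_n :=
  fun w => \col_(i < n) W (g i) w.

(* Families indexed by a subset [D] of a type [I]: the values of [W] outside
   [D] are irrelevant. *)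
Definition gaussian_field {R : realType} {Omega I : Type}
    (E : sublinear_space R Omega) (D : set I) (W : I -> Omega -> R) : Prop :=
  (forall g, D g -> sl_dom E (W g)) /\
  forall n (g : 'I_n -> I), (forall i, D (g i)) -> injective g ->
    G_normal E (subvec W g).

Definition white_noise {R : realType} {Omega : Type}
    (E : sublinear_space R Omega) d (slo shi : R)
    (W : set 'cV[R]_d -> Omega -> R) : Prop :=
  [/\ gaussian_field E (@borel_fin R d) W,
      forall A, borel_fin A ->
        sl_exp E (fun w => W A w ^+ 2) = shi ^+ 2 * fine (lebesgue A) /\
        - sl_exp E (fun w => - W A w ^+ 2) = slo ^+ 2 * fine (lebesgue A) &
      forall A1 A2, borel_fin A1 -> borel_fin A2 -> A1 `&` A2 = set0 ->
        [/\ sl_exp E (fun w => W A1 w * W A2 w) = 0,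
            sl_exp E (fun w => - (W A1 w * W A2 w)) = 0 &
            sl_exp E (fun w => (W (A1 `|` A2) w - W A1 w - W A2 w) ^+ 2) = 0]].

Definition Gfun {R : realType} (slo shi a : R) : R :=
  2^-1 * (shi ^+ 2 * Num.max a 0 - slo ^+ 2 * Num.max (- a) 0).

Definition white_noise_generating {R : realType} {Omega : Type}
    (E : sublinear_space R Omega) d (slo shi : R)
    (W : set 'cV[R]_d -> Omega -> R) : Prop :=
  forall n (A : 'I_n -> set 'cV[R]_d) (Q : 'M[R]_n),
    (forall i, borel_fin (A i)) -> injective A -> Q^T = Q ->
    2^-1 * sl_exp E (fun w => dotp (Q *m subvec W A w) (subvec W A w)) =
    Gfun slo shi
      (\sum_(i < n) \sum_(j < n) Q i j * fine (lebesgue (A i `&` A j))).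

(* [invmx O] is [O] itself when [O] is singular, whence the first conjunct. *)
Definition orthogonal_mx {R : realType} d (O : 'M[R]_d) : Prop :=
  O \in unitmx /\ O^T = invmx O.

Definition rigid_image {R : realType} d (p : 'cV[R]_d) (O : 'M[R]_d)
    (A : set 'cV[R]_d) : set 'cV[R]_d :=
  [set O *m x + p | x in A].

(* Main.v *)
From HB Require Import structures.
Require Import Defs.
From mathcomp Require Import ring lra measurable_realfun.

(** A rigid motion preserves the Lebesgue measures of all the intersections
    [A i `&` A j], so the vectors [(W_(A i))] and [(W_(T (A i)))] have the same
    generating function; and a G-normal law is determined by its generating
    function. Both halves need a proof.

    Invariance of the measure. Lebesgue measure on tuples is translation
    invariant by induction on the dimension ([lebesgue_tuple_shift]). For an
    orthogonal [O], the measure [A |-> lebesgue (O^-1 A)] is translation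
    invariant as well, and two such measures are proportional by an exchange of
    integrals on the product space; testing on the Euclidean unit ball, which
    [O] preserves, shows that the factor is 1 ([lebesgue_orthogonal_ball],
    [lebesgue_rigid_image]).

    Uniqueness of the law. For a G-normal [X] let [P_r u (x) = E[u (x + r X)]].
    By G-normality [P_r P_s = P_t] with [t^2 = r^2 + s^2], so [P_(sqrt t)] is
    the semigroup of the G-heat equation. Viscosity solutions can be avoided,
    because these operators are convex and commute with translations. Let
    [J u] be the average of the translates of [u] against a fixed smooth
    density of compact support. Jensen's inequality gives
    [P_r (J u) <= J (P_r u)] ([gauss_op_mollify]), that is, the mollification of
    a solution is a smooth subsolution. Let [S] be the flow of a second G-normal
    vector with the same generating function. On a mollified function [J u] a
    Taylor expansion shows that [P_r] and [S_r] differ by at most [C r^3], with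
    [C] depending only on the supremum of [u] ([mollify_taylor],
    [gauss_op_expansion], [gauss_op_step]). Hence, writing [u_j] for the first
    flow after [j] steps,
    [J u_(j+1) >= P_r (J u_j) >= S_r (J u_j) - C r^3], and after [n] steps of
    size [M / sqrt n] the losses add up to [C M^3 / sqrt n], which tends to zero:
    [S_M (J u) <= J (P_M u)] ([gauss_op_mollify_compare]). Rescaling removes the
    mollification ([esp_compare_lip]), truncation extends the inequality from
    bounded Lipschitz functions to locally Lipschitz functions of polynomial
    growth, and exchanging the two vectors yields the equality of the laws
    ([G_normal_same_law]). *)

(** * The Euclidean norm *)

Section EuclideanNorm.
Context {R : realType} {n : nat}.
Implicit Types x y z : 'cV[R]_n.

Lemma dotpC x y : dotp x y = dotp y x.
Proof. by apply: eq_bigr => i _; rewrite mulrC. Qed.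

Lemma dotpDl x y z : dotp (x + y) z = dotp x z + dotp y z.
Proof. by rewrite -big_split; apply: eq_bigr => i _; rewrite !mxE mulrDl. Qed.

Lemma dotpZl (a : R) x y : dotp (a *: x) y = a * dotp x y.
Proof. by rewrite mulr_sumr; apply: eq_bigr => i _; rewrite !mxE mulrA. Qed.

Lemma dotpDr x y z : dotp z (x + y) = dotp z x + dotp z y.
Proof. by rewrite dotpC dotpDl !(dotpC z). Qed.

Lemma dotpZr (a : R) x y : dotp x (a *: y) = a * dotp x y.
Proof. by rewrite dotpC dotpZl dotpC. Qed.

Lemma dotpNr x y : dotp x (- y) = - dotp x y.
Proof. by rewrite -scaleN1r dotpZr mulN1r. Qed.

Lemma dotpNl x y : dotp (- x) y = - dotp x y.
Proof. by rewrite dotpC dotpNr dotpC. Qed.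

Lemma dotp_ge0 x : 0 <= dotp x x.
Proof. by apply: sumr_ge0 => i _; rewrite -expr2 sqr_ge0. Qed.

Lemma dotp_mulmx x y : dotp x y = (x^T *m y) 0 0.
Proof. by rewrite mxE; apply: eq_bigr => i _; rewrite !mxE. Qed.

Lemma enorm_ge0 x : 0 <= enorm x.
Proof. exact: sqrtr_ge0. Qed.
Hint Resolve enorm_ge0 : core.

Lemma sqr_enorm x : enorm x ^+ 2 = dotp x x.
Proof. by rewrite sqr_sqrtr ?dotp_ge0. Qed.

Lemma enorm0 : enorm (0 : 'cV[R]_n) = 0.
Proof.
rewrite /enorm /dotp big1 ?sqrtr0// => i _; first by rewrite mxE mul0r.
Qed.

Lemma enormZ (a : R) x : enorm (a *: x) = `|a| * enorm x.
Proof.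
by rewrite /enorm dotpZl dotpZr mulrA -expr2 sqrtrM ?sqr_ge0// sqrtr_sqr.
Qed.

Lemma enormN x : enorm (- x) = enorm x.
Proof. by rewrite -scaleN1r enormZ normrN1 mul1r. Qed.

Lemma enormB x y : enorm (x - y) = enorm (y - x).
Proof. by rewrite -enormN opprB. Qed.

(** Cauchy--Schwarz: [2 (|x|^2 |y|^2 - <x, y>^2)] is the sum of the squares of
    the minors [x_i y_j - x_j y_i]. *)
Lemma dotp_enorm x y : `|dotp x y| <= enorm x * enorm y.
Proof.
rewrite -(@ler_pXn2r _ 2) ?nnegrE ?mulr_ge0//.
rewrite -normrX ger0_norm ?sqr_ge0// exprMn !sqr_enorm.
have H : 0 <= \sum_(i < n) \sum_(j < n) (x i 0 * y j 0 - x j 0 * y i 0) ^+ 2.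
  by apply: sumr_ge0 => i _; apply: sumr_ge0 => j _; rewrite sqr_ge0.
have S (u v : 'cV[R]_n) : dotp u u * dotp v v =
    \sum_(i < n) \sum_(j < n) (u i 0 * v j 0) ^+ 2.
  rewrite /dotp mulr_suml; apply: eq_bigr => i _.
  by rewrite mulr_sumr; apply: eq_bigr => j _; rewrite -!expr2 -exprMn.
have C : dotp x y ^+ 2 =
    \sum_(i < n) \sum_(j < n) (x i 0 * y j 0) * (x j 0 * y i 0).
  rewrite expr2 /dotp mulr_suml; apply: eq_bigr => i _.
  by rewrite mulr_sumr; apply: eq_bigr => j _; ring.
have E : \sum_(i < n) \sum_(j < n) (x i 0 * y j 0 - x j 0 * y i 0) ^+ 2 =
    dotp x x * dotp y y + dotp y y * dotp x x - 2 * dotp x y ^+ 2.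
  rewrite !S C mulr_sumr -big_split -sumrB; apply: eq_bigr => i _ /=.
  rewrite mulr_sumr -big_split -sumrB; apply: eq_bigr => j _ /=; ring.
by move: H; rewrite E; lra.
Qed.

Lemma enormD x y : enorm (x + y) <= enorm x + enorm y.
Proof.
rewrite -(@ler_pXn2r _ 2) ?nnegrE ?addr_ge0//.
rewrite sqr_enorm dotpDl !dotpDr (dotpC y x) sqrrD !sqr_enorm.
have := ler_norm (dotp x y); have := dotp_enorm x y; lra.
Qed.

Lemma coord_enorm x i : `|x i 0| <= enorm x.
Proof.
rewrite -(@ler_pXn2r _ 2) ?nnegrE// -normrX ger0_norm ?sqr_ge0// sqr_enorm.
rewrite /dotp (bigD1 i)//= -expr2 lerDl.
by apply: sumr_ge0 => j _; rewrite -expr2 sqr_ge0.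
Qed.

Lemma enorm_sum x : enorm x <= \sum_(i < n) `|x i 0|.
Proof.
have S0 : 0 <= \sum_(i < n) `|x i 0| by apply: sumr_ge0.
rewrite -(@ler_pXn2r _ 2) ?nnegrE// sqr_enorm expr2 mulr_suml.
apply: ler_sum => i _; apply: (@le_trans _ _ (`|x i 0| * `|x i 0|)).
  by rewrite -normrM ler_norm.
apply: ler_wpM2l => //; rewrite (bigD1 i)//= lerDl.
by apply: sumr_ge0.
Qed.

Lemma dotp_orthogonal (O : 'M[R]_n) x y :
  orthogonal_mx O -> dotp (O *m x) (O *m y) = dotp x y.
Proof.
case=> uO tO.
by rewrite !dotp_mulmx trmx_mul -mulmxA (mulmxA _ O) tO mulVmx// mul1mx.
Qed.

Lemma enorm_orthogonal (O : 'M[R]_n) x :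
  orthogonal_mx O -> enorm (O *m x) = enorm x.
Proof. by move=> hO; rewrite /enorm dotp_orthogonal. Qed.

End EuclideanNorm.
#[global] Hint Extern 0 (is_true (0 <= enorm _)) => exact: enorm_ge0 : core.

Lemma enorm_submx {R : realType} k m (z : 'cV[R]_(k + m)) :
  enorm (usubmx z) <= enorm z /\ enorm (dsubmx z) <= enorm z.
Proof.
have E : dotp z z = dotp (usubmx z) (usubmx z) + dotp (dsubmx z) (dsubmx z).
  rewrite /dotp big_split_ord/=.
  by congr (_ + _); apply: eq_bigr => i _; rewrite !mxE.
have := dotp_ge0 (usubmx z); have := dotp_ge0 (dsubmx z).
by split; rewrite /enorm E ler_sqrt; lra.
Qed.

(** * Borel sets of column vectors and measurable sets of tuples *)

Section BorelTuple.
Context {R : realType} {d : nat}.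
Local Notation T := (d.-tuple (measurableTypeR R)).
Local Notation V := ('cV[R]_d).

Definition vec_of_tuple (t : T) : V := \col_(i < d) tnth t i.

Definition tuple_of_vec (x : V) : T := [tuple x i 0 | i < d].

Lemma tuple_of_vecK : cancel tuple_of_vec vec_of_tuple.
Proof.
by move=> x; apply/colP => i; rewrite mxE tnth_mktuple.
Qed.

(** The topology of the column vectors comes from the sup norm; the Euclidean
    norm has the same open sets. *)
Lemma open_enormP (U : set V) : open U <->
  forall x, U x -> exists2 e : R, 0 < e & forall y, enorm (x - y) < e -> U y.
Proof.
split=> [oU x Ux|H].
  move: oU; rewrite openE => /(_ x Ux)/nbhs_ballP[e /= e0 xeU].
  exists e => // y xy; apply: xeU; split=> // i j.
  rewrite (ord1 j) /ball/= (le_lt_trans _ xy)//.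
  by rewrite (le_trans _ (coord_enorm _ i))// !mxE.
rewrite openE => x /H[e e0 xeU]; apply/nbhs_ballP.
have e1 : 0 < e / d.+1%:R by rewrite divr_gt0.
exists (e / d.+1%:R) => //= y [_ xy]; apply: xeU.
rewrite (le_lt_trans (enorm_sum _))//.
apply: (@le_lt_trans _ _ (\sum_(i < d) e / d.+1%:R)).
  by apply: ler_sum => i _; rewrite !mxE; have := xy i 0; rewrite /ball/= => /ltW.
rewrite sumr_const card_ord -mulrnAl -[_ *+ d]mulr_natr -mulrA gtr_pMr//.
by rewrite ltr_pdivrMr// mul1r ltr_nat.
Qed.

Lemma measurable_tuple_box (a b : 'I_d -> R) : (forall i, a i <= b i) ->
  measurable [set t : T | forall i, a i < tnth t i <= b i].
Proof. by move=> ab; have [] := lebesgue_tuple_box ab. Qed.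

(** An open set is the union of the rational boxes that it contains. *)
Lemma measurable_open_vec_of_tuple (U : set V) :
  open U -> measurable (vec_of_tuple @^-1` U).
Proof.
move/open_enormP => oU.
pose r (n : nat) : R := n.+1%:R^-1.
have r0 n : 0 < r n by rewrite invr_gt0.
pose box (p : 'cV[rat]_d * nat) : set T :=
  [set t | forall i, ratr (p.1 i 0) - r p.2 < tnth t i <= ratr (p.1 i 0) + r p.2].
have mbox p : measurable (box p).
  by apply: measurable_tuple_box => i; have := r0 p.2; lra.
have -> : vec_of_tuple @^-1` U = \bigcup_(p : 'cV[rat]_d * nat)
    (if `[< box p `<=` vec_of_tuple @^-1` U >] then box p else set0).
  apply/seteqP; split=> [t /= Ut|t [p _]]; last first.
    by case: asboolP => // boxU Bt; exact: boxU.
  have [e e0 teU] := oU _ Ut.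
  (* Two points of a box of half-width [r n] are at most [2 d r n] apart. *)
  have [n ne] : exists n, 2 * d.+1%:R * r n < e.
    exists (Num.truncn (2 * d.+1%:R / e)).
    by rewrite /r ltr_pdivrMr// (mulrC e) -ltr_pdivrMr// truncnS_gt.
  have [q Hq] : exists q : 'I_d -> rat, forall i,
      tnth t i - r n < ratr (q i) < tnth t i + r n.
    apply: (@fin_all_exists _ (fun=> rat)
      (fun i q => tnth t i - r n < ratr q < tnth t i + r n)) => i.
    have [q] := @rat_in_itvoo R (tnth t i - r n) (tnth t i + r n)
      (ltac:(have := r0 n; lra)).
    by rewrite in_itv/= => ?; exists q.
  exists (\col_i q i, n) => //; case: asboolP => [_|[]] /=.
    by move=> i /=; rewrite mxE; have := Hq i; lra.
  move=> s /= Hs; apply: teU.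
  rewrite (le_lt_trans (enorm_sum _))// (le_lt_trans _ ne)//.
  apply: (@le_trans _ _ (\sum_(i < d) (2 * r n))).
    apply: ler_sum => i _; have := Hs i; have := Hq i; rewrite !mxE => H1 H2.
    by rewrite ler_norml; apply/andP; split; lra.
  rewrite sumr_const card_ord -[_ *+ d]mulr_natr.
  have := r0 n; have : d%:R <= d.+1%:R :> R by rewrite ler_nat.
  by nra.
apply: countable_bigcupT_measurable => [|p]; first exact: countableP.
by case: asboolP => _ //.
Qed.

Lemma measurable_vec_of_tuple (A : set V) :
  borel A -> measurable (vec_of_tuple @^-1` A).
Proof.
move=> bA; apply: (bA [set B | measurable (vec_of_tuple @^-1` B)]).
split=> /=; last exact: measurable_open_vec_of_tuple.
split=> /= [|B mB|F mF].
- by rewrite preimage_set0.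
- by rewrite setTD preimage_setC; exact: measurableC.
- by rewrite preimage_bigcup; exact: bigcup_measurable.
Qed.

Lemma borel_preimage (f : V -> V) (A : set V) :
  (forall U : set V, open U -> open (f @^-1` U)) ->
  borel A -> borel (f @^-1` A).
Proof.
move=> cf bA; apply: (bA [set B | borel (f @^-1` B)]).
split=> /=; last by move=> U oU; apply: sub_sigma_algebra; exact: cf.
split=> /= [|B mB|F mF].
- by rewrite preimage_set0; exact: sigma_algebra0.
- by rewrite setTD preimage_setC -setTD; exact: sigma_algebraCD.
- by rewrite preimage_bigcup; exact: sigma_algebra_bigcup.
Qed.

End BorelTuple.

(** * Translation invariance of Lebesgue measure *)

Section ProductSections.
Local Open Scope ereal_scope.
Context d1 d2 (T1 : measurableType d1) (T2 : measurableType d2) (R : realType).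
Variable m1 : {sigma_finite_measure set T1 -> \bar R}.
Variable m2 : {sigma_finite_measure set T2 -> \bar R}.

Lemma product_measure1_xsections (S : set (T1 * T2)) :
  (m1 \x m2) S = \int[m1]_x m2 (xsection S x).
Proof. by []. Qed.

Lemma product_measure1_ysections (S : set (T1 * T2)) : measurable S ->
  (m1 \x m2) S = \int[m2]_y m1 (ysection S y).
Proof.
move=> mS; rewrite (@product_measure_unique _ _ _ _ _ m1 m2 (m1 \x^ m2))//.
by move=> A B mA mB; exact: (product_measure2E m1 m2).
Qed.

End ProductSections.

Section Translation.
Local Open Scope ereal_scope.
Context {R : realType}.

Definition real_shift (c : R) (x : measurableTypeR R) : measurableTypeR R :=
  (x + c)%R.

Lemma measurable_real_shift (c : R) : measurable_fun setT (real_shift c).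
Proof. exact: measurable_funD. Qed.

HB.instance Definition _ (c : R) :=
  isMeasurableFun.Build _ _ _ _ (real_shift c) (measurable_real_shift c).

Lemma lebesgue_measure_shift (c : R) (A : set (measurableTypeR R)) :
  measurable A -> lebesgue_measure (real_shift c @^-1` A) = lebesgue_measure A.
Proof.
move=> mA; apply/esym.
apply: (@lebesgue_measure_unique R
  (pushforward lebesgue_measure (real_shift c))) => // _ [[a b]] _ <-.
rewrite /= /pushforward.
rewrite (_ : _ @^-1` _ = `](a - c)%R, (b - c)%R]%classic); last first.
  by apply/seteqP; split=> x /=; rewrite /real_shift !in_itv/=; lra.
rewrite !lebesgue_measure_itv/= !lte_fin ltrD2r.
case: ifP => // _; rewrite -!EFinB; congr EFin; ring.
Qed.

Definition tuple_shift d (c : 'I_d -> R) (t : d.-tuple (measurableTypeR R)) :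
  d.-tuple (measurableTypeR R) := [tuple (tnth t i + c i)%R | i < d].

Lemma measurable_tuple_shift d (c : 'I_d -> R) :
  measurable_fun setT (tuple_shift c).
Proof.
apply/measurable_fun_tnthP => i.
rewrite (_ : _ \o _ = real_shift (c i) \o (fun t => tnth t i)); last first.
  by apply/funext => t /=; rewrite tnth_mktuple.
apply: (measurableT_comp (measurable_real_shift (c i))).
exact: measurable_tnth.
Qed.

HB.instance Definition _ d (c : 'I_d -> R) :=
  isMeasurableFun.Build _ _ _ _ (tuple_shift c) (measurable_tuple_shift c).

Lemma measurable_preimageT d1 d2 (T1 : measurableType d1)
    (T2 : measurableType d2) (f : T1 -> T2) (A : set T2) :
  measurable_fun setT f -> measurable A -> measurable (f @^-1` A).
Proof. by move=> mf mA; rewrite -[X in measurable X]setTI; exact: mf. Qed.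

(** Shift the tail of the tuple inside the sections over its head, and then the
    head inside the sections over the tail. *)
Lemma lebesgue_tuple_shift d (c : 'I_d -> R)
    (A : set (d.-tuple (measurableTypeR R))) : measurable A ->
  lebesgue_tuple d (tuple_shift c @^-1` A) = lebesgue_tuple d A.
Proof.
elim: d c A => [|d IH] c A mA.
  congr (lebesgue_tuple 0 _); apply/seteqP.
  by split=> t /=; rewrite (tuple0 t) (tuple0 (tuple_shift _ _)).
rewrite /= /lebesgue_cons /pushforward.
pose S := @tuple_cons R d @^-1` A.
have mS : measurable S.
  exact: measurable_preimageT (@measurable_tuple_cons R d) mA.
pose c' (i : 'I_d) : R := c (lift ord0 i).
pose f2 (z : measurableTypeR R * d.-tuple (measurableTypeR R)) :=
  (z.1, tuple_shift c' z.2).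
pose f1 (z : measurableTypeR R * d.-tuple (measurableTypeR R)) :
  measurableTypeR R * d.-tuple (measurableTypeR R) := (real_shift (c ord0) z.1, z.2).
have mf2 : measurable_fun setT f2.
  apply: measurable_fun_pair => //.
  exact: (measurableT_comp (measurable_tuple_shift c')).
have mf1 : measurable_fun setT f1.
  apply: measurable_fun_pair => //.
  exact: (measurableT_comp (measurable_real_shift (c ord0))).
have mS2 : measurable (f2 @^-1` S) by exact: measurable_preimageT.
have mS1 : measurable (f1 @^-1` (f2 @^-1` S)) by exact: measurable_preimageT.
have shiftE z : tuple_shift c (tuple_cons z) = tuple_cons (f2 (f1 z)).
  case: z => x t; apply: eq_from_tnth => i; rewrite tnth_mktuple.
  case: (unliftP ord0 i) => [j ->|->]; last by rewrite !tnth0.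
  by rewrite !tnthS tnth_mktuple.
have -> : @tuple_cons R d @^-1` (tuple_shift c @^-1` A) = f1 @^-1` (f2 @^-1` S).
  by apply/seteqP; split=> z; rewrite /S /preimage /= shiftE.
have -> : (@lebesgue_measure R \x lebesgue_tuple d) (f1 @^-1` (f2 @^-1` S)) =
    (@lebesgue_measure R \x lebesgue_tuple d) (f2 @^-1` S).
  rewrite (product_measure1_ysections _ _ mS1) (product_measure1_ysections _ _ mS2).
  apply: eq_integral => t _.
  exact: etrans (lebesgue_measure_shift (c ord0) (measurable_ysection t mS2)).
rewrite !product_measure1_xsections; apply: eq_integral => x _.
exact: etrans (IH c' _ (measurable_xsection x mS)).
Qed.

End Translation.

(** * Invariance of Lebesgue measure under rigid motions *)

Section RigidInvariance.
Context {R : realType} {d : nat}.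
Local Notation T := (d.-tuple (measurableTypeR R)).
Local Notation V := ('cV[R]_d).
Local Notation mu := (@lebesgue_tuple R d).

Lemma lebesgueE (A : set V) : lebesgue A = mu (vec_of_tuple @^-1` A).
Proof. by []. Qed.

Lemma measurable_linear2 (M N : 'M[R]_d) :
  measurable_fun setT (fun z : T * T =>
    tuple_of_vec (M *m vec_of_tuple z.1 + N *m vec_of_tuple z.2)).
Proof.
apply/measurable_fun_tnthP => i.
rewrite (_ : _ \o _ = fun z : T * T =>
    \sum_(j < d) M i j * tnth z.1 j + \sum_(j < d) N i j * tnth z.2 j); last first.
  apply/funext => z /=; rewrite tnth_mktuple !mxE.
  by congr (_ + _); apply: eq_bigr => j _; rewrite mxE.
apply: measurable_funD; apply: measurable_sum => j; apply: measurable_funM => //.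
  exact: (measurableT_comp (measurable_tnth j)).
exact: (measurableT_comp (measurable_tnth j)).
Qed.

Lemma borel_isometry_preimage (f : V -> V) (A : set V) :
  (forall x y, enorm (f x - f y) = enorm (x - y)) ->
  borel A -> borel (f @^-1` A).
Proof.
move=> isof; apply: borel_preimage => U /open_enormP oU.
apply/open_enormP => x /oU[e e0 xeU]; exists e => // y xy.
by apply: xeU; rewrite isof.
Qed.

Lemma borel_unit_ball : borel [set x : V | enorm x < 1].
Proof.
apply: sub_sigma_algebra; apply/open_enormP => x /= x1.
exists (1 - enorm x); first lra.
by move=> y xy; have := enormD (y - x) x; rewrite subrK enormB; lra.
Qed.

Lemma vec_of_tuple_shift (p : V) (t : T) :
  vec_of_tuple (tuple_shift (fun i => p i 0) t) = vec_of_tuple t + p.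
Proof. by apply/colP => i; rewrite !mxE tnth_mktuple. Qed.

Lemma lebesgue_shift (A : set V) (p : V) :
  borel A -> lebesgue [set x | A (x + p)] = lebesgue A.
Proof.
move=> bA; rewrite !lebesgueE.
rewrite -(lebesgue_tuple_shift (fun i => p i 0) (measurable_vec_of_tuple bA)).
congr (mu _); apply/seteqP.
by split=> t /=; rewrite vec_of_tuple_shift.
Qed.

Lemma lebesgue_enorm_ball_gt0_lty :
  (0 < lebesgue [set x : V | (enorm x < 1)%R])%E /\
  (lebesgue [set x : V | (enorm x < 1)%R] < +oo)%E.
Proof.
have mB := measurable_vec_of_tuple borel_unit_ball.
have d0 : 0 < d.+1%:R^-1 :> R by rewrite invr_gt0.
split.
  have ab (i : 'I_d) : (0 : R) <= d.+1%:R^-1 by exact: ltW.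
  have [mbox boxE] := lebesgue_tuple_box ab.
  apply: (@lt_le_trans _ _ (mu [set t | forall i, 0 < tnth t i <= d.+1%:R^-1])).
    by rewrite boxE lte_fin prodr_gt0// => i _; rewrite subr0.
  apply: le_measure; rewrite ?inE// => t /= tbox.
  rewrite (le_lt_trans (enorm_sum _))//.
  apply: (@le_lt_trans _ _ (\sum_(i < d) d.+1%:R^-1)).
    apply: ler_sum => i _; rewrite mxE; have /andP[t0 t1] := tbox i.
    by rewrite gtr0_norm.
  rewrite sumr_const card_ord -[_ *+ d]mulr_natl ltr_pdivrMr// mul1r ltr_nat.
  exact: ltnSn.
have ab (i : 'I_d) : -1 <= (1 : R) by lra.
have [mbox boxE] := lebesgue_tuple_box ab.
apply: (@le_lt_trans _ _ (mu [set t | forall i, -1 < tnth t i <= 1])).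
  apply: le_measure; rewrite ?inE// => t /= tB i.
  have := le_lt_trans (coord_enorm (vec_of_tuple t) i) tB.
  by rewrite mxE ltr_norml => /andP[-> /ltW ->].
by rewrite boxE ltry.
Qed.

(** Both sides are the measure of the pairs [(x, y)] such that [O x + y] lies
    in [A] and [y] in the unit ball [B]. Integrating over [x] first gives the
    left-hand side; shifting [y] by [O x] and then integrating over [x] first
    gives the right-hand side, since the points [x] with [O x] at distance less
    than 1 from [y] form a translate of [B] when [O] is orthogonal. *)
Lemma lebesgue_orthogonal_ball (O : 'M[R]_d) (A : set V)
    (B := [set x : V | enorm x < 1]) : orthogonal_mx O -> borel A ->
  (lebesgue [set x | A (O *m x)] * lebesgue B = lebesgue A * lebesgue B)%E.
Proof.
move=> hO bA; have [uO _] := hO.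
have bB : borel B := borel_unit_ball.
have mA := measurable_vec_of_tuple bA; have mB := measurable_vec_of_tuple bB.
have linI N : measurable_fun setT (fun z : T * T =>
    tuple_of_vec (N *m vec_of_tuple z.1 + 1%:M *m vec_of_tuple z.2)).
  exact: measurable_linear2.
pose S : set (T * T) := [set z | A (O *m vec_of_tuple z.1 + vec_of_tuple z.2) /\
  B (vec_of_tuple z.2)].
pose S' : set (T * T) := [set z | A (vec_of_tuple z.2) /\
  B (vec_of_tuple z.2 - O *m vec_of_tuple z.1)].
have mS : measurable S.
  apply: measurableI.
    have := measurable_preimageT (linI O) mA.
    rewrite (_ : _ @^-1` _ =
      [set z : T * T | A (O *m vec_of_tuple z.1 + vec_of_tuple z.2)])//.
    by apply/seteqP; split=> z /=; rewrite tuple_of_vecK mul1mx.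
  exact: (measurable_preimageT (@measurable_snd _ _ T T) mB).
have mS' : measurable S'.
  apply: measurableI.
    exact: (measurable_preimageT (@measurable_snd _ _ T T) mA).
  have := measurable_preimageT (linI (- O)) mB.
  rewrite (_ : _ @^-1` _ =
    [set z : T * T | B (vec_of_tuple z.2 - O *m vec_of_tuple z.1)])//.
  by apply/seteqP; split=> z /=; rewrite tuple_of_vecK mul1mx mulNmx addrC.
have bOA : borel [set x | A (O *m x)].
  apply: borel_isometry_preimage bA => x y.
  by rewrite -mulmxBr enorm_orthogonal.
have scaleB (m : \bar R) (C : set V) : (0 <= m)%E -> borel C ->
    (\int[mu]_y (m * (\1_(vec_of_tuple @^-1` C) y)%:E) = m * lebesgue C)%E.
  move=> m0 /measurable_vec_of_tuple mC.
  rewrite ge0_integralZl//; last exact: measurableT_comp.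
  by rewrite integral_indic// setIT.
have -> : (lebesgue [set x | A (O *m x)] * lebesgue B)%E = (mu \x mu)%E S.
  rewrite (product_measure1_ysections _ _ mS) -scaleB//.
  apply: eq_integral => y _; rewrite indicE.
  have [yB|yB] := boolP (y \in _); last first.
    rewrite mule0 (_ : ysection S y = set0) ?measure0//.
    apply/seteqP; split=> // x; rewrite /ysection/= inE => -[_] By.
    by move: yB; rewrite notin_setE; apply.
  rewrite mule1 -(lebesgue_shift (invmx O *m vec_of_tuple y) bOA).
  congr (mu _); apply/seteqP; split=> x; rewrite /ysection/= inE /S/=.
    by rewrite mulmxDr mulKVmx// => ?; split=> //; move: yB; rewrite inE.
  by rewrite mulmxDr mulKVmx// => -[].
have -> : (lebesgue A * lebesgue B)%E = (mu \x mu)%E S'.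
  rewrite (product_measure1_ysections _ _ mS') muleC -scaleB//.
  apply: eq_integral => y _; rewrite indicE.
  have [yA|yA] := boolP (y \in _); last first.
    rewrite mule0 (_ : ysection S' y = set0) ?measure0//.
    apply/seteqP; split=> // x; rewrite /ysection/= inE => -[Ay _].
    by move: yA; rewrite notin_setE; apply.
  rewrite mule1 -(lebesgue_shift (- (invmx O *m vec_of_tuple y)) bB).
  have BE (x : V) : enorm (vec_of_tuple y - O *m x) =
      enorm (x - invmx O *m vec_of_tuple y).
    by rewrite -(enorm_orthogonal (x - _) hO) mulmxBr mulKVmx// enormB.
  congr (mu _); apply/seteqP; split=> x; rewrite /ysection/= inE /S'/=.
    by move=> Bx; split; [move: yA; rewrite inE|rewrite /B/= BE].
  by rewrite /B/= BE => -[].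
rewrite !product_measure1_xsections; apply: eq_integral => x _.
apply: etrans (lebesgue_tuple_shift (fun i => (O *m vec_of_tuple x) i 0)
  (measurable_xsection x mS')).
congr (mu _); apply/seteqP; split=> y.
  rewrite /xsection/= !inE /S/S'/= vec_of_tuple_shift addrK (addrC _ (O *m _)).
  by [].
rewrite /xsection/= !inE /S/S'/= vec_of_tuple_shift addrK (addrC _ (O *m _)).
by [].
Qed.

Lemma lebesgue_orthogonal (O : 'M[R]_d) (A : set V) :
  orthogonal_mx O -> borel A -> lebesgue [set x | A (O *m x)] = lebesgue A.
Proof.
move=> hO bA; have [B0 Boo] := lebesgue_enorm_ball_gt0_lty.
have Bfin : lebesgue [set x : V | enorm x < 1] \is a fin_num.
  by rewrite fin_numElt Boo andbT (lt_trans _ B0)// ltNy0.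
have E := lebesgue_orthogonal_ball hO bA.
by apply/le_anti/andP; split; rewrite -(lee_pmul2r Bfin B0) E.
Qed.

Lemma orthogonal_mx_inv (O : 'M[R]_d) :
  orthogonal_mx O -> orthogonal_mx (invmx O).
Proof. by case=> uO tO; split; rewrite ?unitmx_inv// -tO trmxK tO invmxK. Qed.

Lemma rigid_imageE (p : V) (O : 'M[R]_d) (A : set V) : orthogonal_mx O ->
  rigid_image p O A = [set y | A (invmx O *m (y - p))].
Proof.
case=> uO _; apply/seteqP; split=> [_ [x Ax <-]/=|y /= Ay].
  by rewrite addrK mulKmx.
by exists (invmx O *m (y - p)) => //; rewrite mulKVmx// subrK.
Qed.

Lemma borel_rigid_image (p : V) (O : 'M[R]_d) (A : set V) :
  orthogonal_mx O -> borel A -> borel (rigid_image p O A).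
Proof.
move=> hO bA; rewrite rigid_imageE//.
apply: (borel_isometry_preimage (f := fun y => invmx O *m (y - p))) bA => x y.
rewrite -mulmxBr enorm_orthogonal ?opprB ?addrA ?subrK//.
exact: orthogonal_mx_inv.
Qed.

Lemma lebesgue_rigid_image (p : V) (O : 'M[R]_d) (A : set V) :
  orthogonal_mx O -> borel A -> lebesgue (rigid_image p O A) = lebesgue A.
Proof.
move=> hO bA; rewrite rigid_imageE//.
have hO' := orthogonal_mx_inv hO.
rewrite -(lebesgue_orthogonal hO' bA).
rewrite -(@lebesgue_shift [set x | A (invmx O *m x)] (- p))//.
apply: (borel_isometry_preimage (f := fun y => invmx O *m y)) bA => x y.
by rewrite -mulmxBr enorm_orthogonal.
Qed.

Lemma rigid_imageI (p : V) (O : 'M[R]_d) (A B : set V) : orthogonal_mx O ->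
  rigid_image p O (A `&` B) = rigid_image p O A `&` rigid_image p O B.
Proof. by move=> hO; rewrite !rigid_imageE. Qed.

Lemma rigid_image_inj (p : V) (O : 'M[R]_d) :
  orthogonal_mx O -> injective (rigid_image p O).
Proof.
move=> hO A B; have [uO _] := hO; rewrite !rigid_imageE// => AB.
apply/funext => x; have := congr1 (fun C : set V => C (O *m x + p)) AB.
by rewrite /= addrK mulKmx.
Qed.

End RigidInvariance.

(** * Sublinear expectations of Lipschitz functions *)

Section Lipschitz.
Context {R : realType}.

Definition lip k (L : R) (u : 'cV[R]_k -> R) : Prop :=
  forall x y, `|u x - u y| <= L * enorm (x - y).

Lemma lip_clLip k (L : R) (u : 'cV[R]_k -> R) : lip L u -> clLip u.
Proof.
move=> uL; exists (`|L| + 1), 0%N; split; first by rewrite ltr_pwDr.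
move=> x y; rewrite (le_trans (uL x y))//.
rewrite ler_wpM2r ?enorm_ge0// !expr0.
by have := ler_norm L; have := normr_ge0 L; lra.
Qed.

Lemma lip_addl k (L : R) (u : 'cV[R]_k -> R) (x : 'cV[R]_k) :
  lip L u -> lip L (fun y => u (x + y)).
Proof.
move=> uL y z; rewrite (le_trans (uL _ _))//.
by rewrite opprD addrACA subrr add0r.
Qed.

Lemma lip_affine k (L r : R) (u : 'cV[R]_k -> R) (x : 'cV[R]_k) :
  lip L u -> lip (L * `|r|) (fun y => u (x + r *: y)).
Proof.
move=> uL y z; rewrite (le_trans (uL _ _))//.
by rewrite opprD addrACA subrr add0r -scalerBr enormZ mulrA.
Qed.

Lemma lip_enorm k : lip 1 (@enorm R k).
Proof.
move=> x y; rewrite mul1r ler_norml.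
have := enormD (x - y) y; have := enormD (y - x) x.
by rewrite !subrK (enormB y x); lra.
Qed.

End Lipschitz.

Section SublinearExpectation.
Context {R : realType} {Omega : Type} (E : sublinear_space R Omega).
Implicit Types X Y Z : Omega -> R.
Local Notation dom := (sl_dom E).
Local Notation esp := (sl_exp E).

Lemma dom_cst (c : R) : dom (fun=> c).
Proof.
apply: (@sl_dom_comp _ _ E 0 (fun=> c) (fun=> 0)) => [|[]//].
by apply: (@lip_clLip _ _ 0) => x y; rewrite subrr normr0 mul0r.
Qed.

Lemma dom_sum (I : Type) (s : seq I) (F : I -> Omega -> R) :
  (forall i, dom (F i)) -> dom (fun w => \sum_(i <- s) F i w).
Proof.
move=> dF; elim: s => [|i s IH].
  by under eq_fun do rewrite big_nil; exact: dom_cst.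
by under eq_fun do rewrite big_cons; exact: sl_domD.
Qed.

Lemma dom_comp k (phi : 'cV[R]_k -> R) (X : Omega -> 'cV[R]_k) :
  clLip phi -> rvec E X -> dom (fun w => phi (X w)).
Proof. exact: sl_dom_comp. Qed.

(** Multiplication is a locally Lipschitz function on the plane, so the domain
    of the expectation is an algebra; this gives access to moments. *)
Lemma dom_mul X Y : dom X -> dom Y -> dom (fun w => X w * Y w).
Proof.
move=> dX dY.
pose Z w : 'cV[R]_2 := \col_i (if i == 0 then X w else Y w).
rewrite (_ : (fun w => X w * Y w) =
    fun w => (fun z : 'cV[R]_2 => z 0 0 * z 1 0) (Z w)); last first.
  by apply/funext => w; rewrite !mxE.
apply: (@dom_comp 2 (fun z => z 0 0 * z 1 0)) => [|i].
  2: rewrite (_ : (fun w => Z w i 0) = if i == 0 then X else Y).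
  2: by case: ifP.
  2: by apply/funext => w; rewrite mxE; case: ifP.
exists 1, 1%N; split=> // x y; rewrite mul1r !expr1.
have -> : x 0 0 * x 1 0 - y 0 0 * y 1 0 =
    (x - y) 0 0 * x 1 0 + y 0 0 * (x - y) 1 0 by rewrite !mxE; ring.
rewrite (le_trans (ler_normD _ _))// !normrM.
have := coord_enorm (x - y) 0; have := coord_enorm (x - y) 1.
have := coord_enorm x 1; have := coord_enorm y 0.
have := normr_ge0 ((x - y) 0 0); have := normr_ge0 ((x - y) 1 0).
have := normr_ge0 (x 1 0); have := normr_ge0 (y 0 0).
have := enorm_ge0 (x - y).
set a := `|(x - y) 0 0|; set b := `|x 1 0|; set c := `|y 0 0|.
set e := `|(x - y) 1 0|; set n := enorm (x - y) => n0 c0 b0 e0 a0 cy bx en an.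
have : a * b <= n * enorm x by apply: ler_pM.
have : c * e <= enorm y * n by apply: ler_pM.
by lra.
Qed.

Lemma dom_exp X m : dom X -> dom (fun w => X w ^+ m).
Proof.
move=> dX; elim: m => [|m IH]; first by under eq_fun do rewrite expr0; exact: dom_cst.
by under eq_fun do rewrite exprS; exact: dom_mul.
Qed.

Lemma esp_addr (c : R) X : dom X -> esp (fun w => X w + c) = esp X + c.
Proof.
move=> dX; have dc := dom_cst c; apply/eqP; rewrite eq_le; apply/andP; split.
  by rewrite (le_trans (sl_exp_subadd dX dc))// sl_exp_cst.
have := sl_exp_subadd (sl_domD dX dc) (dom_cst (- c)).
under [X in _ (_ X) _]eq_fun do rewrite addrK.
by rewrite sl_exp_cst; lra.
Qed.

Lemma esp_le_add X Y Z : dom X -> dom Y -> dom Z ->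
  (forall w, X w <= Y w + Z w) -> esp X <= esp Y + esp Z.
Proof.
move=> dX dY dZ XYZ; rewrite (le_trans _ (sl_exp_subadd dY dZ))//.
by apply: sl_exp_mono => //; exact: sl_domD.
Qed.

Lemma esp_dist X Y Z : dom X -> dom Y -> dom Z ->
  (forall w, `|X w - Y w| <= Z w) -> `|esp X - esp Y| <= esp Z.
Proof.
move=> dX dY dZ XYZ.
have H1 : esp X <= esp Y + esp Z.
  by apply: esp_le_add => // w; have := XYZ w; rewrite ler_norml; lra.
have H2 : esp Y <= esp X + esp Z.
  by apply: esp_le_add => // w; have := XYZ w; rewrite ler_norml; lra.
by rewrite ler_norml; lra.
Qed.

Lemma esp_dist_cst (c : R) X Y : dom X -> dom Y ->
  (forall w, `|X w - Y w| <= c) -> `|esp X - esp Y| <= c.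
Proof. by move=> dX dY XY; rewrite -(sl_exp_cst E c) esp_dist//; exact: dom_cst. Qed.

Lemma esp_sum (I : Type) (s : seq I) (p : I -> R) (F : I -> Omega -> R) :
  (forall i, 0 <= p i) -> (forall i, dom (F i)) ->
  esp (fun w => \sum_(i <- s) p i * F i w) <= \sum_(i <- s) p i * esp (F i).
Proof.
move=> p0 dF; elim: s => [|i s IH].
  by under eq_fun do rewrite big_nil; rewrite big_nil sl_exp_cst.
under eq_fun do rewrite big_cons; rewrite big_cons.
have dpF j : dom (fun w => p j * F j w) by exact: sl_domZ.
rewrite (le_trans (sl_exp_subadd (dpF i) (dom_sum s dpF)))//.
by rewrite lerD// sl_exp_homo.
Qed.

End SublinearExpectation.

(** * The G-heat flow *)

(** For a G-normal vector [X], [gauss_op E X (sqrt t)] is the time-[t] solution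
    operator of the G-heat equation. *)
Definition gauss_op {R : realType} {Omega : Type} (E : sublinear_space R Omega)
    k (X : Omega -> 'cV[R]_k) (r : R) (u : 'cV[R]_k -> R) : 'cV[R]_k -> R :=
  fun x => sl_exp E (fun w => u (x + r *: X w)).

Section GaussOp.
Context {R : realType} {Omega : Type} (E : sublinear_space R Omega) (k : nat).
Context (X : Omega -> 'cV[R]_k) (rX : rvec E X).
Implicit Types (u v : 'cV[R]_k -> R) (r L U : R).
Local Notation P := (gauss_op E X).

Lemma dom_gauss_op u r L x : lip L u -> sl_dom E (fun w => u (x + r *: X w)).
Proof.
by move=> uL; exact: (dom_comp (lip_clLip (lip_affine r x uL)) rX).
Qed.

Lemma gauss_op_le u v r L L' x : lip L u -> lip L' v ->
  (forall y, u y <= v y) -> P r u x <= P r v x.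
Proof.
move=> uL vL uv; apply: sl_exp_mono => //; exact: dom_gauss_op.
Qed.

Lemma gauss_op_addr u r L c x : lip L u ->
  P r (fun y => u y + c) x = P r u x + c.
Proof. by move=> uL; apply: esp_addr; exact: dom_gauss_op uL. Qed.

Lemma gauss_op_bound u r L U x : lip L u -> (forall y, `|u y| <= U) ->
  `|P r u x| <= U.
Proof.
move=> uL uU; rewrite -(subr0 (P r u x)) -(sl_exp_cst E 0).
apply: esp_dist_cst => [||w]; [exact: dom_gauss_op uL|exact: dom_cst|].
by rewrite subr0.
Qed.

Lemma gauss_op_lip u r L : lip L u -> lip L (P r u).
Proof.
move=> uL x y; apply: esp_dist_cst => [||w]; [exact: dom_gauss_op uL..|].
rewrite (le_trans (uL _ _))//.
by rewrite opprD addrACA subrr addr0.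
Qed.

Lemma gauss_op0 u x : P 0 u x = u x.
Proof.
rewrite /gauss_op; under eq_fun do rewrite scale0r addr0.
by rewrite sl_exp_cst.
Qed.

End GaussOp.

Section GNormal.
Context {R : realType} {Omega : Type} (E : sublinear_space R Omega) (k : nat).
Context (X : Omega -> 'cV[R]_k) (gX : G_normal E X).
Implicit Types (u v : 'cV[R]_k -> R) (r s L U : R).

(** The semigroup property of the flow: the sum of [r X] and [s] times an
    independent copy is averaged over the copy first. *)
Lemma G_normal_semigroup u r s L x : lip L u -> 0 <= r -> 0 <= s ->
  sl_exp E (fun w => u (x + Num.sqrt (r ^+ 2 + s ^+ 2) *: X w)) =
  gauss_op E X r (gauss_op E X s u) x.
Proof.
move=> uL r0 s0; case: gX => rX [Om' [E' [pr [Xb [enl [rXb lXb iXb] gauss]]]]].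
have rX' : rvec E' (fun w => X (pr w)) by move=> i; exact: (enl _ (rX i)).1.
have enlE v L' : lip L' v ->
    sl_exp E' (fun w => v (X (pr w))) = sl_exp E (fun w => v (X w)).
  by move=> vL; apply: (enl _ (dom_comp (lip_clLip vL) rX)).2.
have uxL t y : lip (L * `|t|) (fun z => u (y + t *: z)) by exact: lip_affine.
rewrite -(enlE _ _ (uxL _ x)).
have := gauss r s r0 s0 _ (lip_clLip (lip_addl x uL)) => <-.
pose phi (z : 'cV[R]_(k + k)) := u (x + (r *: usubmx z + s *: dsubmx z)).
have phiL : lip (`|L| * (r + s)) phi.
  move=> y z; rewrite (le_trans (uL _ _))//.
  rewrite opprD addrACA subrr add0r opprD addrACA -!scalerBr -!linearB/=.
  rewrite (le_trans (ler_wpM2r (enorm_ge0 _) (ler_norm L)))// -mulrA ler_wpM2l//.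
  rewrite (le_trans (enormD _ _))// !enormZ !ger0_norm// mulrDl.
  by rewrite lerD// ler_wpM2l// ?(enorm_submx _).1 ?(enorm_submx _).2.
rewrite (_ : (fun w => _) = fun w => phi (col_mx (X (pr w)) (Xb w))); last first.
  by apply/funext => w; rewrite /phi col_mxKu col_mxKd.
rewrite iXb; last exact: lip_clLip phiL.
have PL := gauss_op_lip rX s uL.
rewrite /gauss_op -(enlE _ _ (lip_affine r x PL)); congr (sl_exp E' _).
apply/funext => w.
rewrite -[RHS](enlE _ _ (uxL _ _)).
rewrite -(lXb _ (lip_clLip (uxL _ _))); congr (sl_exp E' _).
by apply/funext => w'; rewrite /phi col_mxKu col_mxKd addrA.
Qed.

(** With [r = s = 1] and a linear function, the mean [m] satisfies
    [sqrt 2 m = 2 m]. *)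
Lemma G_normal_mean0 (b : 'cV[R]_k) : sl_exp E (fun w => dotp b (X w)) = 0.
Proof.
have rX := gX.1.
have bL : lip (enorm b) (dotp b).
  by move=> x y; rewrite -dotpNr -dotpDr dotp_enorm.
have db : sl_dom E (fun w => dotp b (X w)) by exact: dom_comp (lip_clLip bL) rX.
pose m := sl_exp E (fun w => dotp b (X w)).
pose c : R := Num.sqrt (1 ^+ 2 + 1 ^+ 2).
have E1 : sl_exp E (fun w => dotp b (0 + c *: X w)) = c * m.
  rewrite -sl_exp_homo ?sqrtr_ge0//; congr (sl_exp E _).
  by apply/funext => w; rewrite add0r dotpZr.
have E2 x : gauss_op E X 1 (dotp b) x = dotp b x + m.
  rewrite addrC -esp_addr//; congr (sl_exp E _).
  by apply/funext => w; rewrite scale1r dotpDr addrC.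
have E3 : gauss_op E X 1 (gauss_op E X 1 (dotp b)) 0 = m + m.
  rewrite {1}/gauss_op -esp_addr//; congr (sl_exp E _).
  by apply/funext => w; rewrite E2 add0r scale1r.
have := G_normal_semigroup 0 bL ler01 ler01; rewrite -/c E1 E3 => cm.
have c2 : c < 2.
  by rewrite -[ltRHS]ger0_norm// -sqrtr_sqr ltr_sqrt; lra.
have /eqP : (c - 2) * m = 0 by rewrite mulrBl cm mulr_natl mulr2n subrr.
by rewrite mulf_eq0 subr_eq0 (lt_eqF c2) => /eqP.
Qed.

Lemma dom_dotp_quad (Q : 'M[R]_k) : sl_dom E (fun w => dotp (Q *m X w) (X w)).
Proof.
have rX := gX.1.
rewrite (_ : (fun w => _) =
    fun w => \sum_(i < k) \sum_(j < k) Q i j * (X w j 0 * X w i 0)); last first.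
  apply/funext => w; apply: eq_bigr => i _; rewrite mxE mulr_suml.
  by apply: eq_bigr => j _; rewrite mulrA.
by do 2!apply: dom_sum => ?; apply: sl_domZ; apply: dom_mul; exact: rX.
Qed.

Lemma dom_enorm_cube : sl_dom E (fun w => enorm (X w) ^+ 3).
Proof. exact/dom_exp/(dom_comp (lip_clLip (@lip_enorm R k)) gX.1). Qed.

(** The one-step expansion of the G-heat flow: the linear term of a Taylor
    expansion has mean zero, with either sign, and so drops out although the
    expectation is only sublinear. *)
Lemma gauss_op_expansion v L r x (b : 'cV[R]_k) (Q : 'M[R]_k) (K : R) :
  lip L v -> 0 <= r -> 0 <= K ->
  (forall y, `|v (x + y) - (v x + dotp b y + 2^-1 * dotp (Q *m y) y)| <=
     K * enorm y ^+ 3) ->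
  `|gauss_op E X r v x -
    (v x + r ^+ 2 * (2^-1 * sl_exp E (fun w => dotp (Q *m X w) (X w))))| <=
  K * r ^+ 3 * sl_exp E (fun w => enorm (X w) ^+ 3).
Proof.
move=> vL r0 K0 vT; have rX := gX.1.
have K3 : 0 <= K * r ^+ 3 by rewrite mulr_ge0 ?exprn_ge0.
have bL (c : 'cV[R]_k) : lip (enorm c) (dotp c).
  by move=> y z; rewrite -dotpNr -dotpDr dotp_enorm.
have db c : sl_dom E (fun w => dotp c (X w)).
  exact: dom_comp (lip_clLip (bL c)) rX.
have dC : sl_dom E (fun w => r ^+ 2 * (2^-1 * dotp (Q *m X w) (X w))).
  by do 2!apply: sl_domZ; exact: dom_dotp_quad.
pose B w := dotp (r *: b) (X w).
pose C w := r ^+ 2 * (2^-1 * dotp (Q *m X w) (X w)).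
have EC : sl_exp E C =
    r ^+ 2 * (2^-1 * sl_exp E (fun w => dotp (Q *m X w) (X w))).
  rewrite !sl_exp_homo ?exprn_ge0 ?invr_ge0//; first exact: dom_dotp_quad.
  by apply: sl_domZ; exact: dom_dotp_quad.
have EBC : sl_exp E (fun w => B w + C w) = sl_exp E C.
  apply/eqP; rewrite eq_le; apply/andP; split.
    by rewrite (le_trans (sl_exp_subadd (db _) dC))// G_normal_mean0 add0r.
  have := esp_le_add dC (sl_domD (db (r *: b)) dC) (db (- (r *: b))).
  rewrite G_normal_mean0 addr0; apply => w.
  by rewrite /B dotpNl -addrA addrCA subrr addr0.
rewrite -EC -EBC -sl_exp_homo//; last exact: dom_enorm_cube.
rewrite [v x + _]addrC -(esp_addr (v x) (sl_domD (db (r *: b)) dC)).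
apply: esp_dist => [|||w].
- exact: dom_gauss_op vL.
- exact: sl_domD (sl_domD (db _) dC) (dom_cst _ _).
- by apply: sl_domZ; exact: dom_enorm_cube.
have := vT (r *: X w); rewrite enormZ (ger0_norm r0) exprMn mulrA.
rewrite -scalemxAr /B /C !dotpZl !dotpZr.
congr (_ <= _); congr `|_ - _|; ring.
Qed.

End GNormal.

(** * Integration over column vectors *)

Section VectorIntegral.
Context {R : realType} {k : nat}.
Local Notation T := (k.-tuple (measurableTypeR R)).
Local Notation V := ('cV[R]_k).
Local Notation mu := (@lebesgue_tuple R k).
Implicit Types (f g u : V -> R) (x y z p : V).

Definition vmeas f := measurable_fun [set: T] (f \o vec_of_tuple).

(** A class of integrands with finite integrals: the bound [a] on the support
    is not part of the class, which makes it stable under translations. *)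
Definition testfun f := vmeas f /\ exists M a : R,
  forall x, `|f x| <= M /\ (a <= enorm x -> f x = 0).

Definition vint f : R := \int[mu]_(t in setT) f (vec_of_tuple t).

Lemma vmeas_cst (c : R) : vmeas (fun=> c).
Proof. exact: measurable_cst. Qed.

Lemma vmeasD f g : vmeas f -> vmeas g -> vmeas (fun x => f x + g x).
Proof. exact: measurable_funD. Qed.

Lemma vmeasM f g : vmeas f -> vmeas g -> vmeas (fun x => f x * g x).
Proof. exact: measurable_funM. Qed.

Lemma vmeas_coord i : vmeas (fun x => x i 0).
Proof.
rewrite /vmeas (_ : _ \o _ = fun t => tnth t i); first exact: measurable_tnth.
by apply/funext => t /=; rewrite mxE.
Qed.

Lemma vmeas_sum (I : Type) (s : seq I) (F : I -> V -> R) :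
  (forall i, vmeas (F i)) -> vmeas (fun x => \sum_(i <- s) F i x).
Proof. by move=> mF; apply: measurable_sum. Qed.

Lemma vmeas_lip u L : lip L u -> vmeas u.
Proof.
move=> uL; apply: (measurability (@RGenOInfty.G R)).
  exact: RGenOInfty.measurableE.
move=> _ [_ [a ->] <-]; rewrite setTI comp_preimage.
apply: measurable_open_vec_of_tuple; apply/open_enormP => x /=.
rewrite in_itv/= andbT => ax.
have L1 : 0 < `|L| + 1 by rewrite ltr_pwDr.
exists ((u x - a) / (`|L| + 1)); first by rewrite divr_gt0// subr_gt0.
move=> y; rewrite ltr_pdivlMr// => xy; rewrite /= in_itv/= andbT.
have := uL x y; rewrite ler_norml => /andP[_ +].
have : L * enorm (x - y) <= enorm (x - y) * (`|L| + 1).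
  rewrite mulrC ler_wpM2l ?enorm_ge0//.
  by have := ler_norm L; lra.
lra.
Qed.

Lemma testfun_integrable f :
  testfun f -> mu.-integrable setT (EFin \o (f \o vec_of_tuple)).
Proof.
case=> mf [M [a fM]].
pose b := `|a| + 1; pose B := [set t : T | forall i, - b < tnth t i <= b].
have bb : - b <= b by rewrite /b; have := normr_ge0 a; lra.
have [mB BE] := lebesgue_tuple_box (fun _ : 'I_k => bb).
have iB : mu.-integrable setT (fun t => (`|M| * \1_B t)%:E).
  under eq_fun do rewrite EFinM.
  apply: integrableZl => //; apply/integrableP; split.
    exact/measurable_EFinP/measurable_indic.
  under eq_integral do rewrite gee0_abs ?lee_fin//.
  rewrite integral_indic// setIT.
  by apply: (@le_lt_trans _ _ (mu B)); rewrite // BE ltry.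
apply: le_integrable iB => //; first exact/measurable_EFinP.
move=> t _ /=; rewrite lee_fin normrM normr_id.
have [fM' f0] := fM (vec_of_tuple t).
have [ta|ta] := leP a (enorm (vec_of_tuple t)).
  by rewrite f0// normr0 mulr_ge0.
rewrite indicE mem_set ?normr1 ?mulr1 ?(le_trans fM') ?ler_norm// => i.
have ab : a <= b by rewrite /b; have := ler_norm a; lra.
have := le_lt_trans (coord_enorm (vec_of_tuple t) i) (lt_le_trans ta ab).
by rewrite mxE ltr_norml => /andP[-> /ltW ->].
Qed.

Lemma testfunD f g : testfun f -> testfun g -> testfun (fun x => f x + g x).
Proof.
move=> [mf [M [a fM]]] [mg [N [b gN]]]; split; first exact: vmeasD.
exists (M + N), (Num.max a b) => x; split.
  by rewrite (le_trans (ler_normD _ _))// lerD ?(fM x).1 ?(gN x).1.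
by rewrite ge_max => /andP[ax bx]; rewrite (fM x).2// (gN x).2// addr0.
Qed.

(** The factor [g] may be unbounded, as coordinates and Lipschitz functions
    are, because [f] has bounded support. *)
Lemma testfunM g f : vmeas g ->
  (forall a, exists M : R, forall x, enorm x < a -> `|g x| <= M) ->
  testfun f -> testfun (fun x => g x * f x).
Proof.
move=> mg gb [mf [M [a fM]]]; split; first exact: vmeasM.
have [N gN] := gb a; exists (`|N| * `|M|), a => x; split; last first.
  by move=> ax; rewrite (fM x).2// mulr0.
have [ax|ax] := leP a (enorm x); first by rewrite (fM x).2// mulr0 normr0 mulr_ge0.
rewrite normrM ler_pM// ?(le_trans (gN _ ax)) ?(le_trans (fM x).1)//; exact: ler_norm.
Qed.

Lemma testfunZ (c : R) f : testfun f -> testfun (fun x => c * f x).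
Proof.
by move=> tf; apply: (testfunM (vmeas_cst c) _ tf) => a; exists `|c|.
Qed.

Lemma testfun_lip u L f : lip L u -> testfun f -> testfun (fun x => u x * f x).
Proof.
move=> uL; apply: testfunM; first exact: vmeas_lip uL.
move=> a; exists (`|u 0| + `|L| * a) => x xa.
have -> : u x = u 0 + (u x - u 0) by ring.
rewrite (le_trans (ler_normD _ _))// lerD2l (le_trans (uL x 0))// subr0.
rewrite (le_trans (ler_wpM2r (enorm_ge0 _) (ler_norm L)))//.
by rewrite ler_wpM2l// ltW.
Qed.

Lemma testfun_coord i f : testfun f -> testfun (fun x => x i 0 * f x).
Proof.
apply: (testfunM (vmeas_coord i)) => a; exists a => x xa.
by rewrite (le_trans (coord_enorm _ _))// ltW.
Qed.

Lemma testfun_sum (I : Type) (s : seq I) (F : I -> V -> R) :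
  (forall i, testfun (F i)) -> testfun (fun x => \sum_(i <- s) F i x).
Proof.
move=> tF; elim: s => [|i s IH].
  under eq_fun do rewrite big_nil; split; first exact: vmeas_cst.
  by exists 0, 0 => x; rewrite normr0.
by under eq_fun do rewrite big_cons; exact: testfunD.
Qed.

Lemma testfun_shift f p : testfun f -> testfun (fun x => f (x + p)).
Proof.
move=> [mf [M [a fM]]]; split.
  rewrite /vmeas (_ : _ \o _ =
    (f \o vec_of_tuple) \o tuple_shift (fun i => p i 0)); last first.
    by apply/funext => t /=; rewrite vec_of_tuple_shift.
  exact: measurableT_comp.
exists M, (a + enorm p) => x; split; first by rewrite (fM _).1.
move=> xp; apply: (fM _).2; have := enormD (x + p) (- p).
by rewrite addrK enormN; lra.
Qed.

Lemma vintD f g : testfun f -> testfun g ->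
  vint (fun x => f x + g x) = vint f + vint g.
Proof. by move=> tf tg; apply: RintegralD => //; exact: testfun_integrable. Qed.

Lemma vintZ (c : R) f : testfun f -> vint (fun x => c * f x) = c * vint f.
Proof. by move=> tf; apply: RintegralZl => //; exact: testfun_integrable. Qed.

Lemma vint_sum (I : Type) (s : seq I) (F : I -> V -> R) :
  (forall i, testfun (F i)) ->
  vint (fun x => \sum_(i <- s) F i x) = \sum_(i <- s) vint (F i).
Proof.
move=> tF; elim: s => [|i s IH].
  under eq_fun do rewrite big_nil; rewrite big_nil.
  by rewrite /vint /Rintegral integral0.
under eq_fun do rewrite big_cons; rewrite big_cons -IH.
by apply: vintD => //; exact: testfun_sum.
Qed.

Lemma vint_le f g : testfun f -> testfun g -> (forall x, f x <= g x) ->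
  vint f <= vint g.
Proof. by move=> tf tg fg; apply: le_Rintegral => //; exact: testfun_integrable. Qed.

Lemma vint_ge0 f : testfun f -> (forall x, 0 <= f x) -> 0 <= vint f.
Proof.
move=> tf f0; rewrite -[leLHS](mul0r (vint f)) -vintZ//.
by apply: vint_le => // [|x]; [exact: testfunZ|rewrite mul0r].
Qed.

Lemma vint_dist f g h : testfun f -> testfun g -> testfun h ->
  (forall x, `|f x - g x| <= h x) -> `|vint f - vint g| <= vint h.
Proof.
move=> tf tg th fgh.
have H1 : vint f <= vint (fun x => g x + h x).
  apply: vint_le => // [|x]; first exact: testfunD.
  by have := fgh x; rewrite ler_norml; lra.
have H2 : vint g <= vint (fun x => f x + h x).
  apply: vint_le => // [|x]; first exact: testfunD.
  by have := fgh x; rewrite ler_norml; lra.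
by move: H1 H2; rewrite !vintD// ler_norml; lra.
Qed.

Lemma vint_shift f p : testfun f -> vint (fun x => f (x + p)) = vint f.
Proof.
move=> tf; rewrite /vint /Rintegral; congr fine.
have [mf _] := tf.
pose c i := p i 0.
transitivity (\int[pushforward mu (tuple_shift c)]_t (f (vec_of_tuple t))%:E)%E.
  rewrite integral_pushforward//.
  - by apply: eq_integral => t _ /=; rewrite vec_of_tuple_shift.
  - exact/measurable_EFinP.
  - have := testfun_integrable (testfun_shift p tf).
    apply: eq_integrable => // t _ /=; by rewrite vec_of_tuple_shift.
apply: eq_measure_integral => B mB _.
exact: lebesgue_tuple_shift.
Qed.

End VectorIntegral.

(** * Mollification *)

(** The positive part of the cube is twice differentiable with a Lipschitz
    second derivative. *)
Lemma cube_pospart_taylor {R : realType} (p s : R) :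
  `|Num.max (p + s) 0 ^+ 3 - Num.max p 0 ^+ 3 - 3 * Num.max p 0 ^+ 2 * s
    - 3 * Num.max p 0 * s ^+ 2| <= `|s| ^+ 3.
Proof.
rewrite !maxEle; case: (leP (p + s) 0) => h1; case: (leP p 0) => h2.
- by rewrite !expr0n/= !(mulr0, mul0r, subr0) normr0 exprn_ge0.
- have -> : 0 ^+ 3 - p ^+ 3 - 3 * p ^+ 2 * s - 3 * p * s ^+ 2 =
    (- s - p) ^+ 3 - (- s) ^+ 3 :> R by ring.
  have s0 : s < 0 by lra.
  rewrite (ltr0_norm s0) distrC ger0_norm ?subr_ge0 ?lerBlDr ?lerDl; last first.
    by rewrite ler_pXn2r// ?nnegrE; lra.
  by rewrite exprn_ge0//; lra.
- rewrite !expr0n/= !(mulr0, mul0r, subr0) -normrX.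
  have s0 : 0 < s by lra.
  rewrite !ger0_norm ?exprn_ge0//; [|lra|lra].
  by rewrite ler_pXn2r// ?nnegrE; lra.
- by rewrite -normrX le_eqVlt; apply/orP; left; apply/eqP; congr `|_|; ring.
Qed.

Section Mollifier.
Context {R : realType} {k : nat}.
Local Notation V := ('cV[R]_k).
Implicit Types (f g u : V -> R) (x y z p : V).

Definition bump x : R := Num.max (1 - dotp x x) 0.

(** The cube is the least power for which the second derivative is Lipschitz,
    as a Taylor remainder of order three requires. *)
Definition mollifier x : R := bump x ^+ 3.

Definition ball_indic x : R := (enorm x < 1)%R%:R.

Lemma bump_ge0 x : 0 <= bump x.
Proof. by rewrite le_max lexx orbT. Qed.

Lemma bump_le1 x : bump x <= 1.
Proof. by rewrite ge_max ler01 andbT; have := dotp_ge0 x; lra. Qed.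

Lemma bump_eq0 x : 1 <= enorm x -> bump x = 0.
Proof.
move=> x1; apply/max_idPr; rewrite -sqr_enorm subr_le0.
by rewrite -[leLHS](expr1n _ 2) ler_pXn2r ?nnegrE.
Qed.

Lemma testfun_pow_bump m : testfun (fun x => bump x ^+ m.+1).
Proof.
split; last first.
  exists 1, 1 => x; split; last by move/bump_eq0 ->; rewrite expr0n.
  by rewrite ger0_norm ?exprn_ge0 ?bump_ge0// exprn_ile1 ?bump_ge0 ?bump_le1.
apply: measurable_funX; apply: measurable_maxr; last exact: measurable_cst.
apply: measurable_funB; first exact: measurable_cst.
exact: (vmeas_sum _ (fun i => vmeasM (vmeas_coord i) (vmeas_coord i))).
Qed.

Lemma testfun_mollifier : testfun mollifier.
Proof. exact: testfun_pow_bump. Qed.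

Lemma testfun_ball_indic : testfun ball_indic.
Proof.
split; last first.
  exists 1, 1 => x; rewrite /ball_indic; split; last by rewrite leNgt => /negPf ->.
  by case: ltP; rewrite ?normr1 ?normr0.
rewrite /vmeas (_ : _ \o _ = \1_(vec_of_tuple @^-1` [set x | enorm x < 1])).
  apply: measurable_indic; apply: measurable_vec_of_tuple.
  exact: borel_unit_ball.
apply/funext => t; rewrite /= /ball_indic indicE; congr (nat_of_bool _)%:R.
by apply/idP/idP; rewrite inE.
Qed.

Lemma mollifier_ge0 x : 0 <= mollifier x.
Proof. by rewrite exprn_ge0 ?bump_ge0. Qed.

(** The mollifier is bounded below on a small box with a corner at the
    origin. *)
Lemma vint_mollifier_gt0 : 0 < vint mollifier.
Proof.
(* The points of the box of side [e] have norm at most 1/2, so that [bump] is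
   at least 3/4 there. *)
pose e : R := (k.+1%:R * 2)^-1.
have e0 : 0 < e by rewrite invr_gt0 mulr_gt0.
have [mB BE] := @lebesgue_tuple_box R k (fun=> 0) (fun=> e) (fun=> ltW e0).
pose B := [set t : k.-tuple (measurableTypeR R) | forall i, 0 < tnth t i <= e].
rewrite -/B in mB BE.
pose g x : R := (x \in [set x : V | forall i, 0 < x i 0 <= e])%:R.
have gE t : g (vec_of_tuple t) = \1_B t.
  rewrite /g indicE; congr (nat_of_bool _)%:R; apply/idP/idP; rewrite !inE /B/= => H i.
    by have := H i; rewrite mxE.
  by rewrite mxE.
have small x : (forall i, 0 < x i 0 <= e) -> enorm x <= 2^-1.
  move=> xB; rewrite (le_trans (enorm_sum _))//.
  apply: (@le_trans _ _ (\sum_(i < k) e)).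
    by apply: ler_sum => i _; have /andP[x0 x1] := xB i; rewrite gtr0_norm.
  rewrite sumr_const card_ord -[_ *+ k]mulr_natl /e invfM mulrA ler_piMl//.
  by rewrite ler_pdivrMr// mul1r ler_nat.
have tg : testfun g.
  split; last first.
    exists 1, 1 => x; rewrite /g; case: (boolP (_ \in _)) => [|_].
      rewrite inE/= => /small xs; rewrite normr1; split=> // x1.
      by exfalso; lra.
    by rewrite normr0.
  rewrite /vmeas (_ : _ \o _ = \1_B); first exact: measurable_indic.
  exact/funext.
have Ig : 0 < vint g.
  rewrite /vint /Rintegral; under eq_integral do rewrite gE.
  rewrite integral_indic// setIT.
  apply: (eq_ind_r (fun r => 0 < fine r) _ BE).
  by apply: prodr_gt0 => i _; rewrite subr0.
apply: (@lt_le_trans _ _ (vint (fun x => (2^-1) ^+ 3 * g x))).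
  by rewrite vintZ// mulr_gt0// exprn_gt0.
apply: vint_le => // [||x]; [exact: testfunZ|exact: testfun_mollifier|].
rewrite /g; case: (boolP (_ \in _)) => [|_]; last by rewrite mulr0 mollifier_ge0.
rewrite inE/= mulr1 => /small xs.
rewrite ler_pXn2r ?nnegrE ?bump_ge0// le_max -sqr_enorm; apply/orP; left.
have : enorm x ^+ 2 <= (2^-1) ^+ 2 by rewrite ler_pXn2r// nnegrE.
by lra.
Qed.

Definition mollify u : V -> R :=
  fun x => (vint mollifier)^-1 * vint (fun z => u (x + z) * mollifier z).

Lemma testfun_mollify u L x : lip L u ->
  testfun (fun z => u (x + z) * mollifier z).
Proof.
move=> uL; apply: (testfun_lip (lip_addl x uL)); exact: testfun_mollifier.
Qed.

Lemma mollify_cst (c : R) x : mollify (fun=> c) x = c.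
Proof.
rewrite /mollify vintZ; last exact: testfun_mollifier.
by rewrite mulrC mulfK// gt_eqF// vint_mollifier_gt0.
Qed.

Lemma mollify_dist u v L L' x y (c : R) : lip L u -> lip L' v ->
  (forall z, enorm z < 1 -> `|u (x + z) - v (y + z)| <= c) ->
  `|mollify u x - mollify v y| <= c.
Proof.
move=> uL vL uvc; have I0 := vint_mollifier_gt0.
rewrite -mulrBr normrM gtr0_norm ?invr_gt0// mulrC ler_pdivrMr//.
rewrite -vintZ; last exact: testfun_mollifier.
apply: vint_dist; [exact: testfun_mollify uL|exact: testfun_mollify vL|..].
  exact/testfunZ/testfun_mollifier.
move=> z; rewrite -mulrBl normrM (ger0_norm (mollifier_ge0 _)).
have [z1|z1] := ltP (enorm z) 1; first by rewrite ler_wpM2r ?mollifier_ge0 ?uvc.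
by rewrite /mollifier bump_eq0// expr0n !mulr0.
Qed.

Lemma mollify_lip u L : lip L u -> lip L (mollify u).
Proof.
move=> uL x y; apply: (mollify_dist uL uL) => z _.
by rewrite (le_trans (uL _ _))// opprD addrACA subrr addr0.
Qed.

Lemma mollify_close u L x : 0 <= L -> lip L u -> `|mollify u x - u x| <= L.
Proof.
move=> L0 uL; rewrite -[X in _ - X](mollify_cst (u x) x).
have cL : lip 0 (fun _ : V => u x).
  by move=> y z; rewrite subrr normr0 mul0r.
apply: (mollify_dist uL cL) => z z1; rewrite (le_trans (uL _ _))//.
by rewrite addrAC subrr add0r ler_piMr// ltW.
Qed.

End Mollifier.

(** * Taylor expansion of a mollified function *)

Section MollifyTaylor.
Context {R : realType} {k : nat}.
Local Notation V := ('cV[R]_k).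
Implicit Types (f g u : V -> R) (x y z p : V).

(** Substitute [s = 2 <z, y> - |y|^2], the decrease of the squared norm from
    [z] to [z - y], into the expansion of the cube of the positive part. *)
Lemma mollifier_taylor z y :
  `|mollifier (z - y) - (mollifier z + 6 * bump z ^+ 2 * dotp z y
     + (12 * bump z * dotp z y ^+ 2 - 3 * bump z ^+ 2 * dotp y y))|
  <= 152 * enorm y ^+ 3 * (ball_indic z + ball_indic (z - y)).
Proof.
have b0 := bump_ge0 z; have b1 := bump_le1 z.
have n0 := enorm_ge0 y; have m0 := enorm_ge0 z.
have CS := dotp_enorm z y.
have tri : enorm z <= enorm (z - y) + enorm y.
  by have := enormD (z - y) y; rewrite subrK.
have bz := @bump_eq0 R k z; have bzy := @bump_eq0 R k (z - y).
have ub (w : V) : 0 <= ball_indic w by rewrite /ball_indic.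
have yy : dotp y y = enorm y ^+ 2 by rewrite sqr_enorm.
have [out|inn] := boolP ((1 <= enorm z) && (1 <= enorm (z - y))).
  have /andP[/bz z1 /bzy z2] := out.
  rewrite /mollifier z1 z2 !expr0n/= !(mul0r, mulr0) subr0 !addr0 subrr normr0.
  by rewrite !mulr_ge0 ?exprn_ge0 ?addr_ge0.
have big : 1 <= ball_indic z + ball_indic (z - y).
  move: inn; rewrite negb_and -!ltNge /ball_indic => /orP[->|->].
    by rewrite lerDl.
  by rewrite lerDr.
have c0 : 0 <= 152 * enorm y ^+ 3 by rewrite mulr_ge0 ?exprn_ge0.
apply: (le_trans _ (ler_peMr c0 big)) => {c0 big}.
have [y1|y1] := leP (enorm y) 1.
  (* A short increment: [z] is at most 2 long, so [|s| <= 5 |y|]; the constant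
     is [5 ^ 3], plus 27 for the difference of [3 s ^ 2] and [12 <z, y> ^ 2]. *)
  have m2 : enorm z <= 2.
    by move: inn; rewrite negb_and -!ltNge => /orP[]; lra.
  set n := enorm y in n0 y1 tri CS yy *; set c := dotp z y in CS *.
  pose s := 2 * c - n ^+ 2.
  have cn : `|c| <= 2 * n by rewrite (le_trans CS) ?ler_wpM2r.
  have n2 : n ^+ 2 <= n by rewrite expr2 ler_piMl.
  have n20 : 0 <= n ^+ 2 by rewrite exprn_ge0.
  have sn : `|s| <= 5 * n.
    by move: cn; rewrite /s !ler_norml => /andP[? ?]; apply/andP; split; lra.
  have := cube_pospart_taylor (1 - dotp z z) s.
  have -> : 1 - dotp z z + s = 1 - dotp (z - y) (z - y).
    rewrite dotpDl !dotpDr !dotpNl !dotpNr opprK (dotpC y z) -/c yy /s; ring.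
  rewrite -/(bump z) -/(bump (z - y)) -/(mollifier z) -/(mollifier (z - y)).
  set D := (X in `|X| <= _); move=> HD.
  have HD' : `|D| <= 125 * n ^+ 3.
    rewrite (le_trans HD)// (_ : 125 * n ^+ 3 = (5 * n) ^+ 3); last by ring.
    by rewrite ler_pXn2r// nnegrE// mulr_ge0.
  rewrite yy (_ : _ - _ = D + 3 * bump z * (n ^+ 4 - 4 * c * n ^+ 2)); last first.
    by rewrite /D /s; ring.
  rewrite (le_trans (ler_normD _ _))//.
  have -> : 152 * n ^+ 3 = 125 * n ^+ 3 + 3 * 1 * (9 * n ^+ 3) by ring.
  rewrite lerD// !normrM (ger0_norm b0) ger0_norm// ler_pM ?mulr_ge0 ?ler_wpM2l//.
  rewrite (le_trans (ler_normB _ _))//.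
  rewrite (_ : 9 * n ^+ 3 = n ^+ 3 + 8 * n ^+ 3); last by ring.
  rewrite lerD//.
    by rewrite ger0_norm ?exprn_ge0// exprSr ler_piMr// exprn_ge0.
  rewrite normrM (ger0_norm n20) normrM (_ : 8 * n ^+ 3 = 4 * (2 * n) * n ^+ 2); last by ring.
  by rewrite ler_wpM2r// [`|4|]ger0_norm// ler_wpM2l.
(* A long increment: each term separately is at most a multiple of [|y|^3]. *)
have bm : bump z * enorm z <= bump z.
  have [/bz ->|z1] := leP 1 (enorm z); first by rewrite mul0r.
  by rewrite ler_piMr// ltW.
have y3 : 1 <= enorm y ^+ 3 by rewrite exprn_ege1// ltW.
have y13 : enorm y <= enorm y ^+ 3 by rewrite ler_eXnr// ltW.
have y23 : enorm y ^+ 2 <= enorm y ^+ 3 by rewrite ler_weXn2l// ltW.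
have bc : bump z * `|dotp z y| <= enorm y.
  rewrite (le_trans (ler_wpM2l b0 CS))// mulrA ler_piMl// (le_trans bm)//.
have T1 : `|mollifier (z - y)| <= enorm y ^+ 3.
  rewrite (le_trans _ y3)// ger0_norm ?mollifier_ge0//.
  by rewrite exprn_ile1 ?bump_ge0 ?bump_le1.
have T2 : `|mollifier z| <= enorm y ^+ 3.
  by rewrite (le_trans _ y3)// ger0_norm ?mollifier_ge0// exprn_ile1.
have T3 : `|6 * bump z ^+ 2 * dotp z y| <= 6 * enorm y ^+ 3.
  rewrite expr2 !normrM (ger0_norm b0) [`|6|]ger0_norm// -!mulrA ler_wpM2l//.
  by rewrite (le_trans _ y13)// (le_trans _ bc)// ler_piMl// mulr_ge0.
have T4 : `|12 * bump z * dotp z y ^+ 2| <= 12 * enorm y ^+ 3.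
  have [/bz bz0|z1] := leP 1 (enorm z).
    by rewrite bz0 mulr0 mul0r normr0 mulr_ge0 ?exprn_ge0.
  rewrite 2!normrM (ger0_norm b0) [`|12|]ger0_norm// normrX -mulrA ler_wpM2l//.
  rewrite (le_trans _ y23)// (le_trans (ler_piMl _ b1)) ?exprn_ge0//.
  by rewrite ler_pXn2r ?nnegrE// (le_trans CS)// ler_piMl// ltW.
have T5 : `|3 * bump z ^+ 2 * dotp y y| <= 3 * enorm y ^+ 3.
  rewrite yy 2!normrM !normrX (ger0_norm b0) (ger0_norm n0) [`|3|]ger0_norm//.
  rewrite -mulrA ler_wpM2l// (le_trans _ y23)// ler_piMl ?exprn_ge0//.
  by rewrite exprn_ile1.
move: T1 T2 T3 T4 T5 y3; rewrite !ler_norml.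
move=> /andP[? ?] /andP[? ?] /andP[? ?] /andP[? ?] /andP[? ?] ?.
by apply/andP; split; lra.
Qed.

(** The derivatives fall on the mollifier, so the constant [K] depends on [u]
    through its supremum only, and is the same at all times of a flow. *)
Lemma mollify_taylor (U : R) : 0 <= U -> exists2 K : R, 0 <= K &
  forall u L, lip L u -> (forall x, `|u x| <= U) ->
  forall x, exists (b : V) (Q : 'M[R]_k), Q^T = Q /\
  forall y, `|mollify u (x + y) -
    (mollify u x + dotp b y + 2^-1 * dotp (Q *m y) y)| <= K * enorm y ^+ 3.
Proof.
move=> U0; pose I0 := vint (@mollifier R k).
have I0_gt0 : 0 < I0 by exact: vint_mollifier_gt0.
have tB := @testfun_ball_indic R k.
have B0 : 0 <= vint (@ball_indic R k).
  by apply: vint_ge0 => // z; rewrite /ball_indic.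
exists (I0^-1 * (U * 152 * (vint (@ball_indic R k) + vint (@ball_indic R k)))).
  by rewrite !mulr_ge0 ?invr_ge0 ?addr_ge0 ?(ltW I0_gt0).
move=> u L uL uU x.
pose F i z : R := u (x + z) * (6 * (z i 0 * bump z ^+ 2)).
pose G i j z : R := u (x + z) *
  (12 * (z i 0 * (z j 0 * bump z ^+ 1)) + - 3 * (i == j)%:R * bump z ^+ 2).
have tF i : testfun (F i).
  apply: (testfun_lip (lip_addl x uL)); apply: testfunZ; apply: testfun_coord.
  exact: testfun_pow_bump.
have tG i j : testfun (G i j).
  apply: (testfun_lip (lip_addl x uL)); apply: testfunD.
    apply: testfunZ; apply: testfun_coord; apply: testfun_coord.
    exact: testfun_pow_bump.
  by apply: testfunZ; exact: testfun_pow_bump.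
pose b : V := \col_i (I0^-1 * vint (F i)).
pose Q : 'M[R]_k := \matrix_(i, j) (I0^-1 * (2 * vint (G i j))).
exists b, Q; split.
  apply/matrixP => i j; rewrite !mxE; congr (_ * (_ * vint _)).
  by apply/funext => z; rewrite /G eq_sym; ring.
move=> y.
pose S1 z := \sum_i y i 0 * F i z.
pose S2 z := \sum_i \sum_j (y i 0 * y j 0) * G i j z.
have tS1 : testfun S1 by apply: testfun_sum => i; exact: testfunZ.
have tS2i i : testfun (fun z => \sum_j (y i 0 * y j 0) * G i j z).
  by apply: testfun_sum => j; exact: testfunZ.
have tS2 : testfun S2 by exact: testfun_sum.
have S1E z : S1 z = u (x + z) * (6 * bump z ^+ 2 * dotp z y).
  by rewrite /S1 /dotp !mulr_sumr; apply: eq_bigr => i _; rewrite /F; ring.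
have S2E z : S2 z = u (x + z) *
    (12 * bump z * dotp z y ^+ 2 - 3 * bump z ^+ 2 * dotp y y).
  have -> : dotp z y ^+ 2 = \sum_i \sum_j (z i 0 * z j 0 * (y i 0 * y j 0)).
    rewrite expr2 /dotp mulr_suml; apply: eq_bigr => i _.
    by rewrite mulr_sumr; apply: eq_bigr => j _; ring.
  have -> : dotp y y = \sum_i \sum_j ((i == j)%:R * (y i 0 * y j 0)).
    apply: eq_bigr => i _; rewrite (bigD1 i)//= eqxx mul1r big1 ?addr0// => j ji.
    by rewrite eq_sym (negPf ji) mul0r.
  rewrite !mulr_sumr -sumrB mulr_sumr; apply: eq_bigr => i _.
  rewrite !mulr_sumr -sumrB mulr_sumr; apply: eq_bigr => j _.
  by rewrite /G expr1; ring.
have tu (w : V) : testfun (fun z => u (x + w + z) * mollifier z).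
  exact: testfun_mollify uL.
have tu0 : testfun (fun z => u (x + z) * mollifier z).
  exact: testfun_mollify uL.
have tsh : testfun (fun z => u (x + z) * mollifier (z - y)).
  apply: (testfun_lip (lip_addl x uL)); apply: testfun_shift.
  exact: testfun_mollifier.
have vS1 : vint S1 = \sum_i y i 0 * vint (F i).
  rewrite [LHS]vint_sum; last by move=> i; exact: testfunZ.
  by apply: eq_bigr => i _; exact: vintZ.
have vS2 : vint S2 = \sum_i \sum_j (y i 0 * y j 0) * vint (G i j).
  rewrite [LHS]vint_sum//; apply: eq_bigr => i _.
  rewrite [LHS]vint_sum; last by move=> j; exact: testfunZ.
  by apply: eq_bigr => j _; exact: vintZ.
have bE : dotp b y = I0^-1 * vint S1.
  rewrite vS1 mulr_sumr; apply: eq_bigr => i _.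
  by rewrite mxE; ring.
have QE : 2^-1 * dotp (Q *m y) y = I0^-1 * vint S2.
  rewrite vS2 !mulr_sumr; apply: eq_bigr => i _.
  rewrite mxE mulr_suml !mulr_sumr; apply: eq_bigr => j _; rewrite mxE.
  by field; rewrite gt_eqF.
have shE : vint (fun z => u (x + y + z) * mollifier z) =
    vint (fun z => u (x + z) * mollifier (z - y)).
  rewrite -(vint_shift y tsh); congr vint; apply/funext => z.
  by rewrite addrK -addrA (addrC y).
rewrite bE QE /mollify -/I0 shE -mulrDr -mulrDr -mulrBr.
have Ii0 : 0 < I0^-1 by rewrite invr_gt0.
rewrite normrM (gtr0_norm Ii0) -!mulrA; apply: (ler_wpM2l (ltW Ii0)).
rewrite -(vintD tu0 tS1) -(vintD (testfunD tu0 tS1) tS2).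
have tBs := testfun_shift (- y) tB.
have -> : U * (152 * ((vint (@ball_indic R k) + vint (@ball_indic R k)) * enorm y ^+ 3)) =
    vint (fun z => U * 152 * enorm y ^+ 3 * (ball_indic z + ball_indic (z - y))).
  rewrite (vintZ _ (testfunD tB tBs)) (vintD tB tBs) (vint_shift (- y) tB).
  by ring.
apply: (vint_dist tsh (testfunD (testfunD tu0 tS1) tS2)).
  exact: testfunZ _ (testfunD tB tBs).
move=> z; rewrite S1E S2E -!mulrDr -mulrBr normrM.
rewrite -!(mulrA U); apply: ler_pM => //; exact: mollifier_taylor.
Qed.

End MollifyTaylor.

(** * Jensen's inequality for the flow *)

Lemma prod_bool_natr {R : realType} (I : finType) (b : I -> bool) :
  \prod_i (b i)%:R = ([forall i, b i])%:R :> R.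
Proof.
case: forallP => [bT|/existsNP[i /negP bi]].
  by rewrite big1// => i _; rewrite bT.
by rewrite (bigD1 i)//= (negPf bi) mul0r.
Qed.

Section Discretize.
Context {R : realType} {k : nat}.
Local Notation V := ('cV[R]_k).
Implicit Types (f g u : V -> R) (x y z p : V).

(** Dissect the cube around the unit ball into [m ^ k] half-open cells; the
    weights are the masses that the mollifier gives to the cells. The error is
    uniform in [x] and over all [L]-Lipschitz functions. *)
Lemma mollify_discretize (e : R) : 0 < e ->
  exists (I : finType) (w : I -> R) (s : I -> V), (forall i, 0 <= w i) /\
    forall u L x, 0 <= L -> lip L u ->
      `|mollify u x - \sum_i w i * u (x + s i)| <= L * e.
Proof.
move=> e0; pose I0 := vint (@mollifier R k).
have I0_gt0 : 0 < I0 by exact: vint_mollifier_gt0.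
have Ii0 : 0 < I0^-1 by rewrite invr_gt0.
pose m := (Num.truncn (k%:R * 2 / e)).+1.
have m0 : 0 < m%:R :> R by rewrite ltr0n.
have me : k%:R * (2 / m%:R) <= e.
  rewrite mulrA ler_pdivrMr// (mulrC e) -ler_pdivrMr//.
  exact/ltW/truncnS_gt.
pose c (a : nat) : R := -1 + a%:R * (2 / m%:R).
have cS a : c a.+1 = c a + 2 / m%:R by rewrite /c -natr1; ring.
have c_le a : c a <= c a.+1 by rewrite cS lerDl divr_ge0.
have c0 : c 0%N = -1 by rewrite /c mul0r addr0.
have cm : c m = 1 by rewrite /c mulrCA divff ?gt_eqF// mulr1; ring.
pose J := {ffun 'I_k -> 'I_m}.
pose cell (j : J) z := [forall i, c (j i) < z i 0 <= c (j i).+1].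
pose p j z : R := (cell j z)%:R.
pose s (j : J) : V := \col_i c (j i).
have sum1 (r : R) : -1 < r -> r <= 1 ->
    \sum_(a < m) (c a < r <= c a.+1)%R%:R = 1 :> R.
  move=> r0 r1.
  rewrite (eq_bigr (fun a : 'I_m => (r <= c a.+1)%R%:R - (r <= c a)%R%:R)); last first.
    move=> a _; rewrite ltNge; have [ra|ra] /= := leP r (c a).
      by rewrite (le_trans ra (c_le a)) subrr.
    by rewrite subr0.
  rewrite -(big_mkord xpredT (fun a => (r <= c a.+1)%R%:R - (r <= c a)%R%:R)).
  rewrite (telescope_sumr (fun a => (r <= c a)%R%:R))// cm c0 r1.
  by rewrite leNgt r0 subr0.
(* The indicator of a cell is a product over the coordinates, so distributivity
   reduces the sum over all cells to one telescoping sum per coordinate. *)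
have sump z : enorm z < 1 -> \sum_j p j z = 1.
  move=> z1; rewrite /p /cell; under eq_bigr do rewrite -prod_bool_natr.
  rewrite -(bigA_distr_bigA (fun i (a : 'I_m) => (c a < z i 0 <= c a.+1)%R%:R)).
  rewrite big1// => i _; apply: sum1.
    by have := le_lt_trans (coord_enorm z i) z1; rewrite ltr_norml => /andP[].
  by have := le_lt_trans (coord_enorm z i) z1; rewrite ltr_norml => /andP[_ /ltW].
have tp j : testfun (fun z => p j z * mollifier z).
  apply: testfunM (testfun_mollifier); last first.
    by move=> a; exists 1 => z _; rewrite /p; case: (cell j z); rewrite ?normr1 ?normr0.
  have mB := measurable_tuple_box (fun i => c_le (j i)).
  rewrite /vmeas (_ : _ \o _ = \1_[set t : k.-tuple (measurableTypeR R) |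
    forall i, c (j i) < tnth t i <= c (j i).+1]); first exact: measurable_indic.
  apply/funext => t; rewrite /= /p indicE; congr (nat_of_bool _)%:R.
  apply/forallP/idP; rewrite inE /= => H i.
    by have := H i; rewrite mxE.
  by rewrite mxE.
exists J, (fun j => I0^-1 * vint (fun z => p j z * mollifier z)), s; split.
  move=> j; rewrite mulr_ge0 ?(ltW Ii0)// vint_ge0// => z.
  by rewrite mulr_ge0 ?mollifier_ge0.
move=> u L x L0 uL.
have tpu j : testfun (fun z => u (x + s j) * (p j z * mollifier z)).
  exact: testfunZ.
have tS : testfun (fun z => \sum_j u (x + s j) * (p j z * mollifier z)).
  exact: testfun_sum.
have -> : \sum_j I0^-1 * vint (fun z => p j z * mollifier z) * u (x + s j) =
    I0^-1 * vint (fun z => \sum_j u (x + s j) * (p j z * mollifier z)).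
  rewrite [in RHS]vint_sum// mulr_sumr; apply: eq_bigr => j _.
  by rewrite vintZ//; ring.
rewrite /mollify -/I0 -mulrBr normrM (gtr0_norm Ii0).
rewrite mulrC ler_pdivrMr// -vintZ; last exact: testfun_mollifier.
apply: vint_dist => //; first exact: testfun_mollify uL.
  exact: testfunZ testfun_mollifier.
move=> z; have [z1|z1] := leP 1 (enorm z).
  rewrite /mollifier bump_eq0// expr0n/= !mulr0 big1 ?subrr ?normr0//.
  by move=> j _; rewrite !mulr0.
have -> : u (x + z) * mollifier z - \sum_j u (x + s j) * (p j z * mollifier z) =
    \sum_j (p j z * mollifier z) * (u (x + z) - u (x + s j)).
  have -> : u (x + z) * mollifier z = \sum_j p j z * (u (x + z) * mollifier z).
    by rewrite -mulr_suml sump// mul1r.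
  by rewrite -sumrB; apply: eq_bigr => j _; ring.
rewrite (le_trans (ler_norm_sum _ _ _))//.
have -> : L * e * mollifier z = \sum_j (p j z * mollifier z) * (L * e).
  by rewrite -!mulr_suml sump// mul1r mulrC.
apply: ler_sum => j _; rewrite normrM.
rewrite (ger0_norm (mulr_ge0 (ler0n _ _) (mollifier_ge0 _))) /p.
case: (boolP (cell j z)) => [/forallP zj|_]; last by rewrite !mul0r.
rewrite !mul1r; apply: ler_wpM2l; first exact: mollifier_ge0.
rewrite (le_trans (uL _ _))// opprD addrACA subrr add0r ler_wpM2l// (le_trans (enorm_sum _))//.
apply: (@le_trans _ _ (\sum_(i < k) (2 / m%:R))).
  apply: ler_sum => i _; rewrite !mxE; have /andP[zi zi'] := zj i.
  by rewrite ger0_norm ?subr_ge0 ?(ltW zi)// lerBlDl -cS.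
by rewrite sumr_const card_ord -[_ *+ k]mulr_natl.
Qed.

End Discretize.

(** Jensen's inequality for the convex operator [gauss_op], which commutes with
    translations; the mollification is a limit of finite convex combinations
    of translates. *)
Lemma gauss_op_mollify {R : realType} {Omega : Type}
    (E : sublinear_space R Omega) k (X : Omega -> 'cV[R]_k)
    (u : 'cV[R]_k -> R) (L r : R) (x : 'cV[R]_k) :
  rvec E X -> 0 <= L -> lip L u ->
  gauss_op E X r (mollify u) x <= mollify (gauss_op E X r u) x.
Proof.
move=> rX L0 uL; apply/ler_addgt0Pl => e e0.
have L1 : 0 < 2 * (L + 1) by lra.
have [I [w [s [w0 H]]]] := @mollify_discretize R k (e / (2 * (L + 1)))
  (divr_gt0 e0 L1).
have Le : L * (e / (2 * (L + 1))) <= e / 2.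
  have -> : e / 2 = (L + 1) * (e / (2 * (L + 1))) by field; lra.
  by rewrite ler_wpM2r ?divr_ge0 ?ltW//; lra.
have PL := gauss_op_lip rX r uL.
have dI i : sl_dom E (fun w' => u (x + s i + r *: X w')) by exact: dom_gauss_op uL.
have dS : sl_dom E (fun w' => \sum_i w i * u (x + s i + r *: X w')).
  by apply: dom_sum => i; exact: sl_domZ.
have H1 : gauss_op E X r (mollify u) x <=
    sl_exp E (fun w' => \sum_i w i * u (x + s i + r *: X w')) + e / 2.
  rewrite -(sl_exp_cst E (e / 2)); apply: esp_le_add => //.
  - exact: dom_gauss_op (mollify_lip uL).
  - exact: dom_cst.
  move=> w'; have := H u L (x + r *: X w') L0 uL.
  under [in X in X -> _]eq_bigr do rewrite addrAC.
  by rewrite ler_norml; lra.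
have H2 := esp_sum (index_enum I) w0 dI.
have := H _ L x L0 PL; rewrite ler_norml => /andP[H3 _].
move: H1 H2 H3 Le; rewrite /gauss_op; lra.
Qed.

(** * Comparison of two flows *)

Lemma le_add_inv_nat {R : realType} (a b c : R) :
  (forall n : nat, a <= b + c / n.+1%:R) -> a <= b.
Proof.
move=> H; apply/ler_addgt0Pl => e e0.
have := H (Num.truncn (`|c| / e)); set n := _.+1.
have n0 : 0 < n%:R :> R by rewrite ltr0n.
have : c / n%:R <= e.
  rewrite ler_pdivrMr// (mulrC e) -ler_pdivrMr//.
  rewrite (le_trans _ (ltW (truncnS_gt _)))// ler_wpM2r ?ler_norm//.
  by rewrite invr_ge0 ltW.
lra.
Qed.

Section Comparison.
Context {R : realType} {Om1 Om2 : Type} (E1 : sublinear_space R Om1)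
  (E2 : sublinear_space R Om2) (k : nat).
Context (X : Om1 -> 'cV[R]_k) (Y : Om2 -> 'cV[R]_k).
Hypotheses (gX : G_normal E1 X) (gY : G_normal E2 Y).
Hypothesis quad : forall Q : 'M[R]_k, Q^T = Q ->
  sl_exp E1 (fun w => dotp (Q *m X w) (X w)) =
  sl_exp E2 (fun w => dotp (Q *m Y w) (Y w)).
Implicit Types (u v phi : 'cV[R]_k -> R) (L U : R).
Local Notation P := (gauss_op E1 X).
Local Notation S := (gauss_op E2 Y).

(** The second-order terms of the two flows coincide by [quad]. *)
Lemma gauss_op_step U : 0 <= U -> exists C : R, forall u L r x,
  lip L u -> (forall y, `|u y| <= U) -> 0 <= r ->
  S r (mollify u) x <= P r (mollify u) x + C * r ^+ 3.
Proof.
move=> U0; have [K K0 HK] := @mollify_taylor R k U U0.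
exists (K * sl_exp E1 (fun w => enorm (X w) ^+ 3) +
        K * sl_exp E2 (fun w => enorm (Y w) ^+ 3)) => u L r x uL uU r0.
have [b [Q [sQ bQ]]] := HK u L uL uU x.
have := gauss_op_expansion gX (mollify_lip uL) r0 K0 bQ.
have := gauss_op_expansion gY (mollify_lip uL) r0 K0 bQ.
by rewrite (quad sQ) !ler_norml => /andP[_ ?] /andP[? _]; lra.
Qed.

Lemma gauss_op_sqrtS {Om : Type} (E : sublinear_space R Om)
    (Z : Om -> 'cV[R]_k) u L r (j : nat) x : G_normal E Z -> lip L u -> 0 <= r ->
  gauss_op E Z (r * Num.sqrt j.+1%:R) u x =
  gauss_op E Z r (gauss_op E Z (r * Num.sqrt j%:R) u) x.
Proof.
move=> gZ uL r0.
rewrite -(G_normal_semigroup gZ x uL r0) ?mulr_ge0 ?sqrtr_ge0// /gauss_op.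
congr (sl_exp E _); apply/funext => w; congr (u (_ + _ *: _)).
rewrite exprMn sqr_sqrtr// -{1}[r ^+ 2]mulr1 -mulrDr nat1r.
by rewrite sqrtrM ?exprn_ge0// sqrtr_sqr ger0_norm.
Qed.

(** One step loses [C r ^ 3] by [step] and goes in the right direction by
    Jensen's inequality; the later steps of [S] carry these losses along
    unchanged, because [S] is monotone and commutes with adding constants. *)
Lemma gauss_op_iterate u L U (C r : R) (j : nat) x :
  0 <= L -> lip L u -> (forall y, `|u y| <= U) -> 0 <= r ->
  (forall u L r x, lip L u -> (forall y, `|u y| <= U) -> 0 <= r ->
    S r (mollify u) x <= P r (mollify u) x + C * r ^+ 3) ->
  S (r * Num.sqrt j%:R) (mollify u) x <=
  mollify (P (r * Num.sqrt j%:R) u) x + j%:R * (C * r ^+ 3).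
Proof.
move=> L0 uL uU r0 step; elim: j x => [|j IH] x.
  rewrite sqrtr0 mulr0 gauss_op0 mul0r addr0.
  by rewrite (_ : P 0 u = u)//; apply/funext => y; rewrite gauss_op0.
have rX := gX.1; have rY := gY.1.
set t := r * Num.sqrt j%:R in IH.
have muL := mollify_lip uL.
have PL := gauss_op_lip rX t uL.
have PU y : `|P t u y| <= U by exact: (gauss_op_bound rX t y uL uU).
rewrite (gauss_op_sqrtS _ _ gY muL r0) -/t.
have cL : lip L (fun y => mollify (P t u) y + j%:R * (C * r ^+ 3)).
  by move=> y z; rewrite opprD addrACA subrr addr0; exact: mollify_lip.
rewrite (le_trans (gauss_op_le rY r x (gauss_op_lip rY t muL) cL IH))//.
rewrite (gauss_op_addr rY r _ x (mollify_lip PL)).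
have -> : P (r * Num.sqrt j.+1%:R) u = P r (P t u).
  by apply/funext => y; exact: gauss_op_sqrtS uL r0.
have := step _ _ r x PL PU r0.
have := gauss_op_mollify r x rX L0 PL.
by rewrite -natr1; lra.
Qed.

(** With [(m + 1) ^ 2] steps of size [M / (m + 1)] the total loss is
    [C M ^ 3 / (m + 1)]. *)
Lemma gauss_op_mollify_compare u L U (M : R) x :
  0 <= L -> 0 <= U -> lip L u -> (forall y, `|u y| <= U) -> 0 <= M ->
  S M (mollify u) x <= mollify (P M u) x.
Proof.
move=> L0 U0 uL uU M0; have [C step] := gauss_op_step U0.
apply: (@le_add_inv_nat _ _ _ (C * M ^+ 3)) => m.
have m0 : m.+1%:R != 0 :> R by rewrite pnatr_eq0.
have r0 : 0 <= M / m.+1%:R by rewrite divr_ge0.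
have := gauss_op_iterate (m.+1 ^ 2) x L0 uL uU r0 step.
rewrite natrX sqrtr_sqr ger0_norm// divfK//.
have -> : m.+1%:R ^+ 2 * (C * (M / m.+1%:R) ^+ 3) = C * M ^+ 3 / m.+1%:R :> R.
  by field.
by [].
Qed.

(** Stretched by a factor [M], the function [phi] has Lipschitz constant
    [L / M], so that removing the mollifier of unit width costs [L / M] on
    either side; the flow of size [M] compensates for the stretching. *)
Lemma esp_compare_lip phi L U : 0 <= L -> 0 <= U -> lip L phi ->
  (forall y, `|phi y| <= U) ->
  sl_exp E2 (fun w => phi (Y w)) <= sl_exp E1 (fun w => phi (X w)).
Proof.
move=> L0 U0 pL pU; apply: (@le_add_inv_nat _ _ _ (2 * L)) => n.
set M : R := n.+1%:R; have M0 : 0 < M by rewrite ltr0n.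
have rX := gX.1; have rY := gY.1.
pose u x := phi (M^-1 *: x).
have uL : lip (L / M) u.
  move=> x y; rewrite (le_trans (pL _ _))// -scalerBr enormZ mulrA.
  by rewrite gtr0_norm ?invr_gt0.
have LM0 : 0 <= L / M by rewrite divr_ge0 ?(ltW M0).
have uU y : `|u y| <= U by exact: pU.
have uE Om (E : sublinear_space R Om) Z :
    gauss_op E Z M u 0 = sl_exp E (fun w => phi (Z w)).
  congr (sl_exp E _); apply/funext => w.
  by rewrite /u add0r scalerA mulVf ?gt_eqF// scale1r.
have := gauss_op_mollify_compare 0 LM0 U0 uL uU (ltW M0).
have H1 : `|mollify (P M u) 0 - P M u 0| <= L / M.
  exact: mollify_close LM0 (gauss_op_lip rX M uL).
have H2 : `|S M (mollify u) 0 - S M u 0| <= L / M.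
  apply: esp_dist_cst => [||w].
  - exact: (dom_gauss_op rY M 0 (mollify_lip uL)).
  - exact: (dom_gauss_op rY M 0 uL).
  - exact: mollify_close LM0 uL.
move: H1 H2; rewrite !uE !ler_norml => /andP[_ +] /andP[+ _].
by rewrite -(mulrA 2); set q := L / M in LM0 *; lra.
Qed.

End Comparison.

(** * Uniqueness of the G-normal law *)

Section Truncation.
Context {R : realType} {k : nat}.
Implicit Types (x y : 'cV[R]_k) (phi : 'cV[R]_k -> R).

Definition clamp (N r : R) : R := Num.max (- N) (Num.min N r).

Definition vclamp (N : R) x : 'cV[R]_k := \col_i clamp N (x i 0).

Lemma clamp_lip (N r s : R) : 0 <= N -> `|clamp N r - clamp N s| <= `|r - s|.
Proof.
move=> N0; wlog rs : r s / s <= r.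
  move=> H; case: (leP s r) => [/H//|/ltW/H]; by rewrite distrC (distrC s).
rewrite [leRHS]ger0_norm ?subr_ge0// ler_norml /clamp !maxEle !minEle.
have NN : - N <= N by lra.
by case: (leP N r) => ?; case: (leP N s) => ?; rewrite ?NN;
  try case: (leP (- N) r) => ?; try case: (leP (- N) s) => ?;
  apply/andP; split; lra.
Qed.

Lemma clamp_bound (N r : R) : 0 <= N -> `|clamp N r| <= N.
Proof.
move=> N0; rewrite ler_norml /clamp maxEle minEle.
have NN : - N <= N by lra.
by case: (leP N r) => ?; rewrite ?NN; try case: (leP (- N) r) => ?;
  apply/andP; split; lra.
Qed.

Lemma clamp_close (N r : R) : 0 < N -> `|r - clamp N r| <= r ^+ 2 / N.
Proof.
move=> N0; rewrite ler_pdivlMr// /clamp maxEle minEle.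
case: (leP N r) => h1; case: (leP (- N) _) => h2.
- rewrite ger0_norm ?subr_ge0//; nra.
- lra.
- by rewrite subrr normr0 mul0r sqr_ge0.
- rewrite opprK ler0_norm; nra.
Qed.

Lemma enorm_le_coord x y : (forall i, `|x i 0| <= `|y i 0|) ->
  enorm x <= enorm y.
Proof.
move=> xy; rewrite /enorm ler_sqrt ?dotp_ge0//; apply: ler_sum => i _.
by rewrite -!expr2 -[x i 0 ^+ 2]ger0_norm ?sqr_ge0// -[y i 0 ^+ 2]ger0_norm
  ?sqr_ge0// !normrX ler_pXn2r// nnegrE.
Qed.

Lemma vclamp_lip (N : R) x y : 0 <= N ->
  enorm (vclamp N x - vclamp N y) <= enorm (x - y).
Proof.
by move=> N0; apply: enorm_le_coord => i; rewrite !mxE clamp_lip.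
Qed.

Lemma vclamp_bound (N : R) x : 0 <= N -> enorm (vclamp N x) <= k%:R * N.
Proof.
move=> N0; rewrite (le_trans (enorm_sum _))//.
apply: (@le_trans _ _ (\sum_(i < k) N)).
  by apply: ler_sum => i _; rewrite mxE clamp_bound.
by rewrite sumr_const card_ord mulr_natl.
Qed.

Lemma vclamp_close (N : R) x : 0 < N ->
  enorm (x - vclamp N x) <= enorm x ^+ 2 / N.
Proof.
move=> N0; rewrite (le_trans (enorm_sum _))// sqr_enorm /dotp mulr_suml.
by apply: ler_sum => i _; rewrite !mxE -expr2 clamp_close.
Qed.

Lemma vclamp0 (N : R) : 0 <= N -> vclamp N 0 = 0.
Proof.
move=> N0; apply/colP => i; rewrite !mxE.
rewrite /clamp maxEle minEle.
have NN : - N <= N by lra.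
by case: (leP N 0) => ?; rewrite ?NN; try case: (leP (- N) 0) => ?; lra.
Qed.

Lemma vclamp_le (N : R) x : 0 <= N -> enorm (vclamp N x) <= enorm x.
Proof.
by move=> N0; have := vclamp_lip x 0 N0; rewrite vclamp0// !subr0.
Qed.

(** Truncating the argument makes a locally Lipschitz function of polynomial
    growth bounded and Lipschitz. *)
Lemma clLip_vclamp phi (N : R) : 0 <= N -> clLip phi ->
  exists L U : R, [/\ 0 <= L, 0 <= U, lip L (fun x => phi (vclamp N x)) &
    forall x, `|phi (vclamp N x)| <= U].
Proof.
move=> N0 [C [q [C0 phiC]]]; pose B := k%:R * N.
have B0 : 0 <= B by rewrite mulr_ge0.
pose L := C * (1 + B ^+ q + B ^+ q).
have L0 : 0 <= L by rewrite mulr_ge0 ?(ltW C0)// !addr_ge0 ?exprn_ge0.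
have pL : lip L (fun x => phi (vclamp N x)).
  move=> x y; rewrite (le_trans (phiC _ _))// ler_pM ?vclamp_lip//.
    by rewrite mulr_ge0 ?(ltW C0)// !addr_ge0 ?exprn_ge0.
  by rewrite ler_wpM2l ?(ltW C0)// !lerD// lerXn2r ?nnegrE// vclamp_bound.
exists L, (`|phi 0| + L * B); split=> // [|x].
  exact: addr_ge0 (normr_ge0 _) (mulr_ge0 L0 B0).
have -> : phi (vclamp N x) = phi 0 + (phi (vclamp N x) - phi (vclamp N 0)).
  by rewrite vclamp0//; ring.
rewrite (le_trans (ler_normD _ _))// lerD2l//.
rewrite vclamp0// (le_trans (phiC _ _))// subr0 ler_pM ?vclamp_bound//.
  by rewrite mulr_ge0 ?(ltW C0)// !addr_ge0 ?exprn_ge0.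
by rewrite ler_wpM2l ?(ltW C0)// !lerD// lerXn2r ?nnegrE ?vclamp_bound// enorm0.
Qed.

(** The excess of a coordinate over [N] is at most its square over [N], so one
    more power in the moment buys a factor [1 / N] in the truncation error. *)
Lemma clLip_vclamp_close phi : clLip phi -> exists (C : R) (q : nat), 0 <= C /\
  forall N x, 0 < N -> `|phi x - phi (vclamp N x)| <=
    N^-1 * (C * ((1 + enorm x ^+ q + enorm x ^+ q) * enorm x ^+ 2)).
Proof.
move=> [C [q [C0 phiC]]]; exists C, q; split; first exact: ltW.
move=> N x N0; rewrite (le_trans (phiC _ _))//.
rewrite [leRHS](_ : _ =
  C * (1 + enorm x ^+ q + enorm x ^+ q) * (enorm x ^+ 2 / N)); last by ring.
rewrite ler_pM ?vclamp_close//.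
  by rewrite mulr_ge0 ?(ltW C0)// !addr_ge0 ?exprn_ge0.
rewrite ler_wpM2l ?(ltW C0)// lerD// lerXn2r ?nnegrE//.
by rewrite vclamp_le// ltW.
Qed.

End Truncation.

Section LawUniqueness.
Context {R : realType} {Om : Type} (E : sublinear_space R Om) (k : nat).
Implicit Types X Y : Om -> 'cV[R]_k.

Lemma dom_growth X (C : R) q : rvec E X ->
  sl_dom E (fun w => C * ((1 + enorm (X w) ^+ q + enorm (X w) ^+ q)
    * enorm (X w) ^+ 2)).
Proof.
move=> rX.
have dn : sl_dom E (fun w => enorm (X w)).
  exact: dom_comp (lip_clLip (@lip_enorm R k)) rX.
have dq := dom_exp q dn.
apply: sl_domZ; apply: dom_mul; last exact: dom_exp.
by apply: sl_domD => //; apply: sl_domD => //; exact: dom_cst.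
Qed.

Lemma G_normal_esp_le X Y : G_normal E X -> G_normal E Y ->
  (forall Q : 'M[R]_k, Q^T = Q ->
    sl_exp E (fun w => dotp (Q *m X w) (X w)) =
    sl_exp E (fun w => dotp (Q *m Y w) (Y w))) ->
  forall phi, clLip phi ->
  sl_exp E (fun w => phi (Y w)) <= sl_exp E (fun w => phi (X w)).
Proof.
move=> gX gY quad phi cphi; have rX := gX.1; have rY := gY.1.
have [C [q [C0 close]]] := clLip_vclamp_close cphi.
pose D (Z : Om -> 'cV[R]_k) w := C * ((1 + enorm (Z w) ^+ q + enorm (Z w) ^+ q)
    * enorm (Z w) ^+ 2).
apply: (@le_add_inv_nat _ _ _ (sl_exp E (D X) + sl_exp E (D Y))) => n.
set N : R := n.+1%:R; have N0 : 0 < N by rewrite ltr0n.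
have [L [U [L0 U0 pL pU]]] := clLip_vclamp (ltW N0) cphi.
have mid := esp_compare_lip gX gY quad L0 U0 pL pU.
have trunc Z : rvec E Z ->
    `|sl_exp E (fun w => phi (Z w)) - sl_exp E (fun w => phi (vclamp N (Z w)))|
    <= N^-1 * sl_exp E (D Z).
  move=> rZ; have dD := dom_growth C q rZ.
  rewrite -sl_exp_homo ?invr_ge0 ?(ltW N0)//; apply: esp_dist.
  - exact: dom_comp cphi rZ.
  - exact: dom_comp (lip_clLip pL) rZ.
  - exact: sl_domZ.
  - by move=> w; exact: close.
rewrite mulrDl -!(mulrC N^-1).
move: (trunc _ rX) (trunc _ rY) mid; rewrite !ler_norml.
set a := N^-1 * sl_exp E (D X); set b := N^-1 * sl_exp E (D Y).
by move=> /andP[+ _] /andP[_ +]; lra.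
Qed.

(** The hypothesis on the second moments is symmetric in [X] and [Y], so the
    comparison holds in both directions. *)
Lemma G_normal_same_law X Y : G_normal E X -> G_normal E Y ->
  (forall Q : 'M[R]_k, Q^T = Q ->
    sl_exp E (fun w => dotp (Q *m X w) (X w)) =
    sl_exp E (fun w => dotp (Q *m Y w) (Y w))) ->
  same_law E X Y.
Proof.
move=> gX gY quad phi cphi; apply/le_anti/andP; split.
  by apply: G_normal_esp_le => // Q sQ; rewrite quad.
exact: G_normal_esp_le.
Qed.

End LawUniqueness.

(** * Invariance of the white noise *)

Lemma borelI {R : realType} d (A B : set 'cV[R]_d) :
  borel A -> borel B -> borel (A `&` B).
Proof. exact: (@measurableI _ (g_sigma_algebraType (@open 'cV[R]_d))). Qed.

Lemma clLip_comp {R : realType} k m (phi : 'cV[R]_m -> R)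
    (g : 'cV[R]_k -> 'cV[R]_m) (c : R) :
  (forall x y, enorm (g x - g y) <= c * enorm (x - y)) ->
  (forall x, enorm (g x) <= c * enorm x) -> 1 <= c ->
  clLip phi -> clLip (fun x => phi (g x)).
Proof.
move=> gL gB c1 [C [q [C0 phiC]]].
have c0 : 0 < c by exact: lt_le_trans c1.
exists (C * c ^+ q * c), q; split; first by rewrite !mulr_gt0 ?exprn_gt0.
have pow (z : 'cV[R]_k) : enorm (g z) ^+ q <= c ^+ q * enorm z ^+ q.
  by rewrite -exprMn lerXn2r ?nnegrE ?mulr_ge0 ?(ltW c0).
move=> x y; rewrite (le_trans (phiC _ _))//.
have -> : C * c ^+ q * c * (1 + enorm x ^+ q + enorm y ^+ q) * enorm (x - y) =
  C * (c ^+ q + c ^+ q * enorm x ^+ q + c ^+ q * enorm y ^+ q) *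
  (c * enorm (x - y)) by ring.
rewrite ler_pM//; first by rewrite mulr_ge0 ?(ltW C0)// !addr_ge0 ?exprn_ge0.
by rewrite ler_wpM2l ?(ltW C0)// !lerD// exprn_ege1.
Qed.

Definition reindex {R : realType} m n (f : 'I_n -> 'I_m) (x : 'cV[R]_m) :
  'cV[R]_n := \col_i x (f i) 0.

Lemma enorm_reindex {R : realType} m n (f : 'I_n -> 'I_m) (x : 'cV[R]_m) :
  enorm (reindex f x) <= n.+1%:R * enorm x.
Proof.
rewrite (le_trans (enorm_sum _))//.
apply: (@le_trans _ _ (\sum_(i < n) enorm x)).
  by apply: ler_sum => i _; rewrite mxE coord_enorm.
by rewrite sumr_const card_ord -[_ *+ n]mulr_natl ler_wpM2r ?enorm_ge0// ler_nat.
Qed.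

Lemma clLip_reindex {R : realType} m n (f : 'I_n -> 'I_m) (phi : 'cV[R]_n -> R) :
  clLip phi -> clLip (fun x => phi (reindex f x)).
Proof.
apply: (@clLip_comp _ _ _ _ _ n.+1%:R) => [x y|x|].
- have -> : reindex f x - reindex f y = reindex f (x - y).
    by apply/colP => i; rewrite !mxE.
  exact: enorm_reindex.
- exact: enorm_reindex.
- by rewrite ler1n.
Qed.

(** The finite-dimensional laws of a field are prescribed for distinct indices
    only; repetitions among the sets are removed by a reindexing. *)
Lemma family_undup (T : eqType) (x0 : T) n (A : 'I_n -> T) :
  exists m (A' : 'I_m -> T) (f : 'I_n -> 'I_m),
    [/\ injective A', (forall i, A i = A' (f i)) & forall j, exists i, A' j = A i].
Proof.
pose s := undup (codom A).
have As i : A i \in s by rewrite mem_undup codom_f.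
have lt i : (index (A i) s < size s)%N by rewrite index_mem.
exists (size s), (fun j => nth x0 s j), (fun i => Ordinal (lt i)); split.
- move=> j1 j2 /eqP; rewrite nth_uniq ?undup_uniq//.
  by move=> /eqP; exact: val_inj.
- by move=> i /=; rewrite nth_index.
- move=> j; have : nth x0 s j \in codom A by rewrite -mem_undup mem_nth.
  by move=> /codomP.
Qed.

Theorem proposition24 (R : realType) (Omega : Type)
    (E : sublinear_space R Omega) (d : nat) (slo shi : R)
    (W : set 'cV[R]_d -> Omega -> R)
    (hs0 : 0 <= slo ^+ 2) (hs : slo ^+ 2 <= shi ^+ 2)
    (hW : white_noise E slo shi W)
    (hG : white_noise_generating E slo shi W)
    (p : 'cV[R]_d) (O : 'M[R]_d) (hO : orthogonal_mx O)
    (n : nat) (A : 'I_n -> set 'cV[R]_d) (hA : forall i, borel_fin (A i)) :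
  same_law E (subvec W A) (subvec W (fun i => rigid_image p O (A i))).
Proof.
have [[_ gW] _ _] := hW.
have [m [A' [f [injA' AA' A'A]]]] := family_undup set0 A.
pose TA' j := rigid_image p O (A' j).
have finA' j : borel_fin (A' j) by have [i ->] := A'A j.
have finTA' j : borel_fin (TA' j).
  have [bA fA] := finA' j; split; first exact: borel_rigid_image.
  by rewrite lebesgue_rigid_image.
have injTA' : injective TA' by move=> i j /(rigid_image_inj hO)/injA'.
have law : same_law E (subvec W A') (subvec W TA').
  apply: G_normal_same_law; [exact: gW..|] => Q sQ.
  (* Both generating functions are [Gfun] at the same real number, because the
     rigid motion preserves the measures of the pairwise intersections. *)
  have half : 2^-1 != 0 :> R by rewrite invr_neq0.
  apply: (mulfI half); rewrite !hG//; congr (Gfun slo shi _).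
  apply: eq_bigr => i _; apply: eq_bigr => j _; congr (_ * fine _).
  rewrite /TA' -rigid_imageI// lebesgue_rigid_image//.
  by apply: borelI; [exact: (finA' i).1|exact: (finA' j).1].
move=> phi cphi.
have -> : (fun w => phi (subvec W A w)) =
    fun w => phi (reindex f (subvec W A' w)).
  by apply/funext => w; congr phi; apply/colP => i; rewrite !mxE AA'.
have -> : (fun w => phi (subvec W (fun i => rigid_image p O (A i)) w)) =
    fun w => phi (reindex f (subvec W TA' w)).
  by apply/funext => w; congr phi; apply/colP => i; rewrite !mxE AA'.
exact: (law _ (clLip_reindex f cphi)).
Qed.
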